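(* Let $\lambda_1,\lambda_2\in\mathbb{C}$ be generic scalars (i.e. $(\lambda_1,\lambda_2)$ lies outside a suitable countable union of proper Zariski-closed subsets of $\mathbb{C}^2$). Then the $\mathbb{C}$-linear category $\mathcal{C}_{(\lambda_1+1,\lambda_2)}$ is not a Krull-Schmidt category; specifically, the object $M^{(\lambda_1,\lambda_2,1)}$ of this category violates the Krull-Schmidt property: its decomposition as a direct sum is not unique (up to isomorphism and reordering of indecomposable summands).
   Context: Let $\kappa=(\kappa_1,\kappa_2)$ be variables and $\mathcal{R}_2$ the ring of integer-valued polynomials in $\kappa_1,\kappa_2$. Compositions are finite sequences of nonnegative integers up to trailing zeros. Let $T_\kappa$ be the set of sequences $\alpha=(\kappa_1+\sigma_1,\kappa_2+\sigma_2,\tau_1,\tau_2,\ldots)$ with $\sigma\in\mathbb{Z}^2$, $\tau$ a composition, $\sigma_1+\sigma_2+|\tau|=0$. For $\alpha,\beta\in T_\kappa$, $T_\kappa(\alpha,\beta)$ is the set of matrices $q=(q_{ij})$ (rows indexed by positions of $\beta$, columns by positions of $\alpha$) with $q_{ii}\in\kappa_i+\mathbb{Z}$ for $i=1,2$, all other entries in $\mathbb{Z}_{\ge0}$, row sums $\beta$, column sums $\alpha$. $\mathcal{C}_\kappa^{(0)}$ is the $\mathcal{R}_2$-linear category with objects $M^\alpha$ ($\alpha\in T_\kappa$), $\mathrm{Hom}(M^\alpha,M^\beta)$ free over $\mathcal{R}_2$ on symbols $\xi_q$, $q\in T_\kappa(\alpha,\beta)$, and composition, for $r\in T_\kappa(\beta,\gamma)$,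 $s\in T_\kappa(\alpha,\beta)$, $$\xi_r\xi_s=\sum_{q\in T_\kappa(\alpha,\gamma)}\Big(\sum_A\prod_{i,k}\frac{(\sum_j a_{ijk})!}{\prod_j a_{ijk}!}\Big)\xi_q,$$ over 3-tensors $A=(a_{ijk})$ with $a_{iii}\in\kappa_i+\mathbb{Z}$ for $i=1,2$, all other entries in $\mathbb{Z}_{\ge0}$, $\sum_k a_{ijk}=r_{ij}$, $\sum_j a_{ijk}=q_{ik}$, $\sum_i a_{ijk}=s_{jk}$ (multinomials read as polynomials: $N!/(N-b)!=N(N-1)\cdots(N-b+1)$). The category $\mathcal{C}_{(\lambda_1+1,\lambda_2)}$ over $\mathbb{C}$ is obtained by extending scalars along $\mathcal{R}_2\to\mathbb{C}$, $\kappa_1\mapsto\lambda_1+1$, $\kappa_2\mapsto\lambda_2$, and then taking the Karoubian envelope (adjoining finite direct sums and splitting idempotents). The object $M^{(\lambda_1,\lambda_2,1)}$ is the one indexed by $(\kappa_1-1,\kappa_2,1)\in T_\kappa$. *)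

(* Defs.v *)
From HB Require Import structures.
From mathcomp Require Import all_boot all_order all_algebra.
From mathcomp Require Import ring complex freeg mpoly.
From mathcomp Require Import boolp classical_sets functions cardinality fsbigop.
From mathcomp Require Import reals.

Set Implicit Arguments.
Unset Strict Implicit.
Unset Printing Implicit Defensive.

Import Order.TTheory GRing.Theory Num.Theory.
Local Open Scope classical_set_scope.
Local Open Scope ring_scope.

(** * Linear categories *)

(* The data of a K-linear category.  The space of morphisms from X to Y is the
   subset [hom X Y] of the K-module [mor X Y]: morphisms of a Karoubian
   envelope form a subspace of the morphisms of the original category.
   The category axioms are not recorded, since none of the notions below needs
   them in order to be defined. *)
Record linCat (K : nzRingType) := LinCat {
  obj : Type;
  mor : obj -> obj -> lmodType K;
  hom : forall X Y, set (mor X Y);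
  idm : forall X, mor X X;
  comp : forall X Y Z, mor Y Z -> mor X Y -> mor X Z
}.

Arguments hom {K l} X Y.
Arguments idm {K l} X.
Arguments comp {K l X Y Z} g f.

Section Decompositions.
Context {K : nzRingType} {C : linCat K}.
Implicit Types X Y : obj C.

Definition iso X Y : Prop :=
  exists (f : mor X Y) (g : mor Y X),
    [/\ hom X Y f, hom Y X g, comp g f = idm X & comp f g = idm Y].

Definition is_zero_obj X : Prop := idm X = 0.

(* X is the direct sum of the Y k. *)
Definition direct_sum X n (Y : 'I_n -> obj C) : Prop :=
  exists (inj : forall k, mor (Y k) X) (prj : forall k, mor X (Y k)),
    [/\ (forall k, hom (Y k) X (inj k) /\ hom X (Y k) (prj k)),
        (forall k, comp (prj k) (inj k) = idm (Y k)),
        (forall k l, k != l -> comp (prj k) (inj l) = 0)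
      & \sum_k comp (inj k) (prj k) = idm X].

Definition indecomposable X : Prop :=
  ~ is_zero_obj X /\
  forall Y : 'I_2 -> obj C, direct_sum X Y -> exists k, is_zero_obj (Y k).

Definition decomposition X n (Y : 'I_n -> obj C) : Prop :=
  direct_sum X Y /\ forall k, indecomposable (Y k).

Definition unique_decomposition X : Prop :=
  forall m n (Y : 'I_m -> obj C) (Z : 'I_n -> obj C),
    decomposition X Y -> decomposition X Z ->
    exists s : 'I_m -> 'I_n, bijective s /\ forall k, iso (Y k) (Z (s k)).

End Decompositions.

Definition krull_schmidt (K : nzRingType) (C : linCat K) : Prop :=
  forall X : obj C,
    (exists n (Y : 'I_n -> obj C), decomposition X Y) /\ unique_decomposition X.

(** * The Karoubian envelope *)

Section AdditiveClosure.
Context {K : nzRingType} (C : linCat K).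

Definition ac_obj : Type := {n & 'I_n -> obj C}.

Definition ac_mor (X Y : ac_obj) : Type :=
  forall (j : 'I_(tag Y)) (i : 'I_(tag X)), mor (tagged X i) (tagged Y j).

Section MorModule.
Variables X Y : ac_obj.
Implicit Types f g h : ac_mor X Y.

HB.instance Definition _ := gen_eqMixin (ac_mor X Y).
HB.instance Definition _ := gen_choiceMixin (ac_mor X Y).

Definition ac_zero : ac_mor X Y := fun j i => 0.
Definition ac_opp f : ac_mor X Y := fun j i => - f j i.
Definition ac_add f g : ac_mor X Y := fun j i => f j i + g j i.
Definition ac_scale a f : ac_mor X Y := fun j i => a *: f j i.

Lemma ac_morP f g : (forall j i, f j i = g j i) -> f = g.
Proof. by move=> fg; apply: functional_extensionality_dep => j;
  apply: functional_extensionality_dep => i. Qed.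

Fact ac_addA : associative ac_add.
Proof. by move=> f g h; apply: ac_morP => j i; apply: addrA. Qed.
Fact ac_addC : commutative ac_add.
Proof. by move=> f g; apply: ac_morP => j i; apply: addrC. Qed.
Fact ac_add0 : left_id ac_zero ac_add.
Proof. by move=> f; apply: ac_morP => j i; apply: add0r. Qed.
Fact ac_addN : left_inverse ac_zero ac_opp ac_add.
Proof. by move=> f; apply: ac_morP => j i; apply: addNr. Qed.

HB.instance Definition _ :=
  GRing.isZmodule.Build (ac_mor X Y) ac_addA ac_addC ac_add0 ac_addN.

Fact ac_scaleA a b f : ac_scale a (ac_scale b f) = ac_scale (a * b) f.
Proof. by apply: ac_morP => j i; apply: scalerA. Qed.
Fact ac_scale1 : left_id 1 ac_scale.
Proof. by move=> f; apply: ac_morP => j i; apply: scale1r. Qed.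
Fact ac_scaleDr : right_distributive ac_scale +%R.
Proof. by move=> a f g; apply: ac_morP => j i; apply: scalerDr. Qed.
Fact ac_scaleDl f : {morph ac_scale^~ f : a b / a + b}.
Proof. by move=> a b; apply: ac_morP => j i; apply: scalerDl. Qed.

HB.instance Definition _ := GRing.Zmodule_isLmodule.Build K (ac_mor X Y)
  ac_scaleA ac_scale1 ac_scaleDr ac_scaleDl.

End MorModule.

Definition ac_id (X : ac_obj) : ac_mor X X := fun j i =>
  if i =P j is ReflectT e
  then eq_rect i (fun j => mor (tagged X i) (tagged X j)) (idm _) j e
  else 0.

Definition ac_comp (X Y Z : ac_obj) (g : ac_mor Y Z) (f : ac_mor X Y) :
  ac_mor X Z := fun k i => \sum_j comp (g k j) (f j i).

(* Objects: finite formal direct sums; morphisms: matrices of morphisms. *)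
Definition additive_closure : linCat K :=
  @LinCat K ac_obj (fun X Y => ac_mor X Y : lmodType K)
    (fun X Y => [set f | forall j i, hom _ _ (f j i)]) ac_id ac_comp.

Definition ac_single (X : obj C) : obj additive_closure :=
  existT _ 1%N (fun=> X).

End AdditiveClosure.

Section IdempotentCompletion.
Context {K : nzRingType} (C : linCat K).

Record idempotent := Idempotent {
  idem_obj : obj C;
  idem_map : mor idem_obj idem_obj;
  idem_hom : hom idem_obj idem_obj idem_map;
  idemK : comp idem_map idem_map = idem_map
}.

Definition idempotent_completion : linCat K :=
  @LinCat K idempotent (fun e f => mor (idem_obj e) (idem_obj f))
    (fun e f => [set u | [/\ hom (idem_obj e) (idem_obj f) u,
                             comp (idem_map f) u = u & comp u (idem_map e) = u]])
    idem_map (fun _ _ _ => comp).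

End IdempotentCompletion.

Definition karoubian_envelope (K : nzRingType) (C : linCat K) : linCat K :=
  idempotent_completion (additive_closure C).

Section KaroubianObject.
Context {K : nzRingType} {C : linCat K} (X : obj C).
Hypothesis homX : hom X X (idm X).
Hypothesis idmK : comp (idm X) (idm X) = idm X.

Let acX := ac_single X.

Lemma ac_single_hom : hom acX acX (idm acX).
Proof.
move=> j i; rewrite /= /ac_id; case: eqP => [e|]; last by rewrite !ord1.
by case: _ / e.
Qed.

Lemma ac_single_idem : comp (idm acX) (idm acX) = idm acX.
Proof.
apply: ac_morP => j i; rewrite /= /ac_comp big_ord_recl big_ord0 addr0 !ord1.
rewrite /ac_id; case: eqP => // e.
by rewrite (eq_irrelevance e (erefl _)) /= idmK.
Qed.

Definition karoubian_obj : obj (karoubian_envelope C) :=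
  @Idempotent K (additive_closure C) acX (idm acX) ac_single_hom ac_single_idem.

End KaroubianObject.

(** * Categories with free modules of morphisms *)

(* The data of a K-linear category whose modules of morphisms are free, given
   by bases (one of which contains each identity) and products of basis
   elements. *)
Record freeCat (K : nzRingType) := FreeCat {
  fobj : Type;
  fbasis : fobj -> fobj -> choiceType;
  fid : forall X, fbasis X X;
  fmul : forall X Y Z, fbasis Y Z -> fbasis X Y -> {freeg (fbasis X Z) / K}
}.

Definition linCat_of (K : nzRingType) (C : freeCat K) : linCat K :=
  @LinCat K (fobj C) (fun X Y => {freeg (fbasis X Y) / K} : lmodType K)
    (fun _ _ => setT) (fun X => << fid X >>)
    (fun X Y Z g f => fglift (fun r => fglift (fun s => fmul r s) f) g).

Definition fgmap (K L : nzRingType) (phi : K -> L) (T : choiceType)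
    (D : {freeg T / K}) : {freeg T / L} :=
  \sum_(x <- dom D) << phi (coeff x D) *g x >>.

(* The tensor product with L over K of the free K-module on a set is the free
   L-module on the same set. *)
Definition extend_scalars (K L : nzRingType) (phi : {rmorphism K -> L})
    (C : freeCat K) : freeCat L :=
  @FreeCat L (fobj C) (@fbasis K C) (@fid K C)
    (fun X Y Z r s => fgmap phi (fmul r s)).

(** * Integer-valued polynomials in two variables *)

Definition int_valued : {pred {mpoly rat[2]}} :=
  fun p => `[< forall z : 'I_2 -> int, p.@[fun i => (z i)%:~R] \is a Num.int >].

Lemma int_valuedP p :
  reflect (forall z : 'I_2 -> int, p.@[fun i => (z i)%:~R] \is a Num.int)
          (p \in int_valued).
Proof. exact: asboolP. Qed.

Fact int_valued_subring : subring_closed int_valued.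
Proof.
split.
- by apply/int_valuedP => z; rewrite meval1 rpred1.
- move=> p q /int_valuedP pP /int_valuedP qP; apply/int_valuedP => z.
  by rewrite mevalB rpredB.
- move=> p q /int_valuedP pP /int_valuedP qP; apply/int_valuedP => z.
  by rewrite mevalM rpredM.
Qed.

HB.instance Definition _ :=
  GRing.isSubringClosed.Build {mpoly rat[2]} int_valued int_valued_subring.

(* The ring R_2; the variables kappa_1 and kappa_2 are 'X_0 and 'X_1. *)
Record R2 := R2Sub { R2_poly :> {mpoly rat[2]}; _ : R2_poly \in int_valued }.

HB.instance Definition _ := [isSub for R2_poly].
HB.instance Definition _ := [Choice of R2 by <:].
HB.instance Definition _ := [SubChoice_isSubComNzRing of R2 by <:].

(* The specialization kappa_1 |-> x, kappa_2 |-> y. *)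
Definition specialize (F : numFieldType) (x y : F) (p : R2) : F :=
  mmap ratr (fun i : 'I_2 => if i == ord0 then x else y) (R2_poly p).

Section Specialize.
Variables (F : numFieldType) (x y : F).

Fact specialize_is_zmod_morphism : zmod_morphism (specialize x y).
Proof. by move=> p q; rewrite /specialize /= rmorphB. Qed.
Fact specialize_is_monoid_morphism : monoid_morphism (specialize x y).
Proof. by split=> [|p q]; rewrite /specialize /= ?rmorph1 ?rmorphM. Qed.

HB.instance Definition _ :=
  GRing.isZmodMorphism.Build R2 F (specialize x y) specialize_is_zmod_morphism.
HB.instance Definition _ :=
  GRing.isMonoidMorphism.Build R2 F (specialize x y)
    specialize_is_monoid_morphism.

End Specialize.

(** * The category C_kappa^(0) *)

(* Positions are numbered from 0, and an element of kappa_i + Z is represented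
   by its integer part: subtract kappa_1 and kappa_2 from the entries 0 and 1
   of a sequence of T_kappa, and from the entries (0,0) and (1,1) of a matrix
   of T_kappa(alpha, beta), and so on.  Since every sequence of T_kappa has the
   positions 0 and 1, the terms kappa_i cancel from the conditions on row and
   column sums. *)

(* Trailing zeros are removed. *)
Record composition := Composition {
  parts :> seq nat;
  _ : last 1%N parts != 0%N
}.

Record Tseq := TSeq {
  shift1 : int;
  shift2 : int;
  tail : composition;
  _ : shift1 + shift2 + (sumn tail)%:Z = 0
}.

Definition len (a : Tseq) : nat := (size (tail a)).+2.

Definition entry (a : Tseq) (i : nat) : int :=
  match i with
  | 0 => shift1 a
  | 1 => shift2 a
  | i'.+2 => (nth 0%N (tail a) i')%:Z
  end.

Definition is_Tmx (a b : Tseq) (q : 'M[int]_(len b, len a)) : bool :=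
  [&& [forall i : 'I_(len b), forall j : 'I_(len a),
         ~~ ((i == j :> nat) && (i < 2)%N) ==> (0 <= q i j)],
      [forall i, \sum_j q i j == entry b i]
    & [forall j, \sum_i q i j == entry a j]].

Record Tmx (a b : Tseq) := TMx {
  Tmx_mx :> 'M[int]_(len b, len a);
  _ : is_Tmx Tmx_mx
}.

HB.instance Definition _ a b := [isSub for @Tmx_mx a b].
HB.instance Definition _ a b := [Choice of Tmx a b by <:].

Definition tensor (m n p : nat) := {ffun 'I_m * 'I_n * 'I_p -> int}.

Definition is_Ttensor (a b c : Tseq) (r : Tmx b c) (s : Tmx a b) (q : Tmx a c) :
  set (tensor (len c) (len b) (len a)) :=
  [set A | [/\ (forall (i : 'I_(len c)) (j : 'I_(len b)) (k : 'I_(len a)),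
                  ~~ [&& i == j :> nat, j == k :> nat & (i < 2)%N] ->
                  0 <= A (i, j, k)),
               (forall i j, \sum_k A (i, j, k) = r i j),
               (forall i k, \sum_j A (i, j, k) = q i k)
             & (forall j k, \sum_i A (i, j, k) = s j k)]].

(* The factor (\sum_j a_ijk)! / \prod_j a_ijk! at (i, k).  For i = k < 2 let N
   be the sum of the a_iji, an element of kappa_i + Z, and b be the sum of the
   a_iji for j <> i; then N! / a_iii! = N (N - 1) ... (N - b + 1). *)
Definition multinomial m n p (A : tensor m n p) (i : 'I_m) (k : 'I_p) :
    {mpoly rat[2]} :=
  if (i == k :> nat) && (i < 2)%N then
    let N := 'X_(inord i) + (\sum_j A (i, j, k))%:~R in
    let b := (\sum_(j < n | j != i :> nat) absz (A (i, j, k)))%N in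
    (\prod_(j < n | j != i :> nat) (absz (A (i, j, k)))`!)%N%:R^-1
      *: \prod_(t < b) (N - t%:R)
  else
    ((\sum_j absz (A (i, j, k)))`!%N%:R
       / (\prod_j (absz (A (i, j, k)))`!)%N%:R)%:MP.

Lemma prod_fact_dvdn (I : finType) (P : pred I) (f : I -> nat) :
  (\prod_(i | P i) (f i)`! %| (\sum_(i | P i) f i)`!)%N.
Proof.
elim/big_rec2: _ => // i x y _ IH.
rewrite -(bin_fact (leq_addr x (f i))) addKn.
by rewrite dvdn_mull // dvdn_mul.
Qed.

Lemma fact_dvd_prod (z : int) b : (b`!%:Z %| \prod_(t < b) (z - t%:Z))%Z.
Proof.
elim: b z => [|b IHb] z; first by rewrite big_ord0.
have S x : \prod_(t < b.+1) (x + 1 - t%:Z)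
    = \prod_(t < b.+1) (x - t%:Z) + b.+1%:Z * \prod_(t < b) (x - t%:Z).
  rewrite big_ord_recl [in RHS]big_ord_recr /= subr0.
  have -> : \prod_(i < b) (x + 1 - (bump 0 i)%:Z) = \prod_(t < b) (x - t%:Z).
    by apply: eq_bigr => i _; rewrite /bump add1n intS; ring.
  by rewrite intS; ring.
have D x : (b.+1`!%:Z %| b.+1%:Z * \prod_(t < b) (x - t%:Z))%Z.
  by rewrite factS PoszM dvdz_mul.
elim: z => [|n IHn|n IHn].
- by rewrite big_ord_recl subrr mul0r dvdz0.
- by rewrite intS addrC S rpredD.
- have := S (- n.+1%:Z).
  have -> : - n.+1%:Z + 1 = - n%:Z by rewrite intS; ring.
  move/(congr1 (+%R^~ (- (b.+1%:Z * \prod_(t < b) (- n.+1%:Z - t%:Z))))).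
  by rewrite addrK => <-; rewrite rpredB.
Qed.

Lemma multinomial_int m n p (A : tensor m n p) i k :
  multinomial A i k \in int_valued.
Proof.
apply/int_valuedP => z; rewrite /multinomial.
have frac_int (a b : nat) : (b %| a)%N -> a%:R / b%:R \is a @Num.int rat.
  case/dvdnP=> c ->; case: (b =P 0%N) => [->|/eqP b0].
    by rewrite muln0 mul0r rpred0.
  by rewrite natrM mulfK ?pnatr_eq0 // rpred_nat.
case: ifP => _; last by rewrite mevalC frac_int // prod_fact_dvdn.
rewrite mevalZ (rmorph_prod (meval _)) /=.
set f := fun j : 'I_n => absz (A (i, j, k)).
set b := (\sum_(j < n | _) _)%N; set s := \sum_j _.
rewrite (eq_bigr (fun t : 'I_b => (z (inord i) + s - t%:Z)%:~R)); last first.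
  by move=> t _; rewrite mevalB mevalD mevalXU !(rmorph_int, rmorph_nat)
    rmorphB rmorphD.
rewrite -rmorph_prod /=.
have /dvdzP[w ->] := fact_dvd_prod (z (inord i) + s) b.
rewrite rmorphM /= mulrCA rpredM ?intr_int // mulrC frac_int //.
exact: prod_fact_dvdn.
Qed.

Definition tensor_coef m n p (A : tensor m n p) : R2 :=
  \prod_i \prod_k R2Sub (multinomial_int A i k).

Definition xi_mul (a b c : Tseq) (r : Tmx b c) (s : Tmx a b) :
    {freeg (Tmx a c) / R2} :=
  \sum_(q \in setT) << \sum_(A \in is_Ttensor r s q) tensor_coef A *g q >>.

Definition diag_mx_of (a : Tseq) : 'M[int]_(len a) :=
  \matrix_(i, j) if i == j then entry a i else 0.

Lemma sum_diag (I : finType) (i : I) (V : nmodType) (x : V) :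
  \sum_j (if i == j then x else 0) = x.
Proof.
rewrite (bigD1 i) //= eqxx big1 ?addr0 // => j ji.
by rewrite eq_sym (negbTE ji).
Qed.

Fact diag_is_Tmx a : is_Tmx (diag_mx_of a).
Proof.
apply/and3P; split.
- apply/forallP => i; apply/forallP => j; apply/implyP; rewrite mxE -val_eqE /=.
  by case: eqP => //= _; case: (nat_of_ord i) => [|[|k]].
- apply/forallP => i; rewrite -[in eqbRHS](sum_diag i (entry a i)).
  by apply/eqP/eq_bigr => j _; rewrite mxE.
- apply/forallP => j; rewrite -[in eqbRHS](sum_diag j (entry a j)).
  apply/eqP/eq_bigr => i _; rewrite mxE eq_sym.
  by case: eqP => // ->.
Qed.

Definition Tdiag (a : Tseq) : Tmx a a := TMx (diag_is_Tmx a).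

Definition diag_tensor (a : Tseq) : tensor (len a) (len a) (len a) :=
  [ffun u : 'I_(len a) * 'I_(len a) * 'I_(len a) =>
     if (u.1.1 == u.1.2) && (u.1.2 == u.2) then entry a u.1.1 else 0].

Lemma Ttensor_diagE a (q : Tmx a a) :
  is_Ttensor (Tdiag a) (Tdiag a) q =
  [set A | q = Tdiag a /\ A = diag_tensor a].
Proof.
apply/seteqP; split=> A /=.
- case=> A0 Ar Aq As.
  have AE : A = diag_tensor a.
    apply/ffunP=> -[[i j] k]; rewrite ffunE /=.
    have A1 (i' j' k' : 'I_(len a)) : i' != j' -> A (i', j', k') = 0.
      move=> ij; apply/eqP; move: (Ar i' j'); rewrite mxE (negbTE ij).
      move/eqP; rewrite psumr_eq0 => [/allP/(_ k')|k'' _].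
        by rewrite mem_index_enum => /(_ isT).
      by apply: A0; rewrite val_eqE (negbTE ij).
    have A2 (i' j' k' : 'I_(len a)) : j' != k' -> A (i', j', k') = 0.
      move=> jk; apply/eqP; move: (As j' k'); rewrite mxE (negbTE jk).
      move/eqP; rewrite psumr_eq0 => [/allP/(_ i')|i'' _].
        by rewrite mem_index_enum => /(_ isT).
      by apply: A0; rewrite !val_eqE (negbTE jk) andbF.
    have [ij|/A1->//] := eqVneq i j; have [jk|/A2->//] := eqVneq j k.
    rewrite -jk -ij; move: (Ar i i); rewrite mxE eqxx => <-.
    by rewrite (bigD1 i) //= big1 ?addr0 // => l li; rewrite A2 // eq_sym.
  split=> //; apply/val_inj/matrixP => i k /=; rewrite -Aq AE mxE.
  rewrite (bigD1 i) //= big1 => [|j ji]; rewrite ffunE /= ?eqxx ?addr0 //=.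
  by rewrite eq_sym (negbTE ji).
- case=> -> ->; split=> [i j k|i j|i j|i j].
  + rewrite ffunE /= -!val_eqE /= => /negP H; case: ifP => // /andP[ij jk].
    move: H; rewrite ij jk /=; case: (nat_of_ord i) => [|[|l]] //.
  + rewrite mxE -[RHS](sum_diag j); apply: eq_bigr => k _; rewrite ffunE /=.
    by case: (i == j); case: (j == k).
  + rewrite mxE -[RHS](sum_diag i); apply: eq_bigr => k _; rewrite ffunE /=.
    by case: eqP => [->|] //=; case: eqP.
  + rewrite mxE -[RHS](sum_diag i); apply: eq_bigr => k _; rewrite ffunE /=.
    by rewrite eq_sym; case: eqP => [->|].
Qed.

Lemma tensor_coef_diag a : tensor_coef (diag_tensor a) = 1.
Proof.
rewrite /tensor_coef big1 // => i _; rewrite big1 // => k _.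
apply: val_inj; rewrite /= /multinomial.
have H (j : 'I_(len a)) : j != i -> diag_tensor a (i, j, k) = 0.
  by move=> ji; rewrite ffunE /= eq_sym (negbTE ji).
have prodf (n : nat) (P : pred 'I_n) (f : 'I_n -> nat) :
  (forall j, P j -> f j = 0%N) -> (\prod_(j | P j) (f j)`! = 1)%N.
  by move=> f0; rewrite big1 // => j /f0 ->.
case: ifP => _.
  rewrite prodf => [|j ji]; last by rewrite H.
  rewrite invr1 scale1r.
  set b := (\sum_(j < len a | _) _)%N.
  have : b = 0%N by apply: big1 => j ji; rewrite H.
  by case: b => // _; rewrite big_ord0.
rewrite (bigD1 i) //= [in X in _ / X](bigD1 i) //=.
rewrite prodf => [|j ji]; last by rewrite H.
rewrite big1 => [|j ji]; last by rewrite H.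
by rewrite addn0 muln1 divff // pnatr_eq0 -lt0n fact_gt0.
Qed.

Lemma xi_mul_diag a : xi_mul (Tdiag a) (Tdiag a) = << Tdiag a >>.
Proof.
rewrite /xi_mul -(fsbig_widen [set Tdiag a]) //.
  rewrite fsbig_set1 Ttensor_diagE.
  have -> : [set A | Tdiag a = Tdiag a /\ A = diag_tensor a]
      = [set diag_tensor a] by apply/seteqP; split=> A /=; [case|].
  by rewrite fsbig_set1 tensor_coef_diag.
move=> q /= [_ qa]; rewrite Ttensor_diagE.
have -> : [set A | q = Tdiag a /\ A = diag_tensor a] = set0.
  by apply/seteqP; split=> A //= -[].
by rewrite fsbig_set0 freegU0.
Qed.

Definition C_kappa0 : freeCat R2 :=
  @FreeCat R2 Tseq (fun a b => Tmx a b) Tdiag xi_mul.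

(** * The category C_(x, y) *)

Section Specialization.
Variables (F : numFieldType) (x y : F).

Definition C_linear : linCat F :=
  linCat_of (extend_scalars (specialize x y) C_kappa0).

Definition C_spec : linCat F := karoubian_envelope C_linear.

Lemma C_linear_idmK (a : obj C_linear) : comp (idm a) (idm a) = idm a.
Proof.
rewrite /= !liftU !scale1r xi_mul_diag.
by rewrite /fgmap domU1 big_seq1 coeffU eqxx mulr1 rmorph1.
Qed.

(* The object M^alpha. *)
Definition Mobj (a : Tseq) : obj C_spec :=
  @karoubian_obj F C_linear a I (C_linear_idmK a).

End Specialization.

(* The sequence (kappa_1 - 1, kappa_2, 1). *)
Definition alpha1 : Tseq :=
  @TSeq (-1) 0 (@Composition [:: 1%N] isT) erefl.

(** * Generic points of the complex plane *)

Definition eval2 (F : fieldType) (p : {mpoly F[2]}) (v : F * F) : F :=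
  p.@[fun i : 'I_2 => if i == ord0 then v.1 else v.2].

Definition zariski_closed (F : fieldType) (Z : set (F * F)) : Prop :=
  exists S : set {mpoly F[2]}, Z = [set v | forall p, S p -> eval2 p v = 0].

Definition for_generic (F : fieldType) (P : F -> F -> Prop) : Prop :=
  exists Z : nat -> set (F * F),
    (forall n, zariski_closed (Z n) /\ Z n <> setT) /\
    forall x y, ~ (\bigcup_n Z n) (x, y) -> P x y.

(* Main.v *)
Require Import Defs.
From HB Require Import structures.
From mathcomp Require Import all_boot all_order all_algebra.
From mathcomp Require Import ring zify.
From mathcomp Require Import finmap complex freeg mpoly.
From mathcomp Require Import boolp classical_sets functions cardinality fsbigop.
From mathcomp Require Import reals.
Import Defs.

Set Implicit Arguments.
Unset Strict Implicit.
Unset Printing Implicit Defensive.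

Import Order.TTheory GRing.Theory Num.Theory.
Local Open Scope classical_set_scope.
Local Open Scope ring_scope.

(** Write x = l1 + 1 and y = l2, let M be the object of (kappa_1 - 1, kappa_2, 1)
    and let P and Q be those of (kappa_1, kappa_2) and (kappa_1 - 1, kappa_2 + 1).
    Merging the last entry of M with the first one, and splitting it off again,
    are morphisms between M and P whose composite on P is the scalar x; with the
    second entry and Q the scalar is y + 1 [merge_split_off].  Away from the two
    lines x = 0 and y + 1 = 0, both P and Q are therefore direct summands of M.

    The morphisms are filtered by the sum of the off-diagonal entries of a
    matrix: composition is compatible with the filtration [strc_offdeg], and
    between objects with two rows its leading coefficients are products of
    binomial coefficients, so they do not vanish [strc_top, two_row_lead].  Hence
    the endomorphism rings of P and Q have no zero divisors and both objects are
    indecomposable [two_row_domain], while all morphisms between P and Q have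
    positive degree and P is not isomorphic to Q [two_row_not_retract].

    On the other hand P + Q is not a summand of M.  Taking coinvariants of
    the symmetric group, which makes sense for these interpolated permutation
    modules, is a functor that sends each of M, P and Q to a line
    [trivial_functorM, trivial_functor1].  It kills any complement of Q in M,
    so no summand of such a complement is isomorphic to P.  A decomposition of M
    that starts with P thus cannot be matched with one that starts with Q
    [not_unique_decomposition].

    Such decompositions exist because the number of orthogonal idempotents of
    End(M) is bounded [alpha1_orth_bound]: right multiplication by a suitable
    element raises the degree of every nonzero endomorphism by exactly 2, while
    the number of basis elements of degree at most d grows linearly with d.

    All this needs associativity of composition, also for objects other than M,
    since the summands in a direct sum decomposition are arbitrary objects of the
    envelope.  Let c(r,s;q) be the coefficient of xi_q in xi_r xi_s, and let e_ij
    be a matrix unit.  Then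
      r_ij c(r,s;q) = sum_k q_ik c(r - e_ij, s - e_jk; q - e_ik)
    and symmetrically for s [strc_recl, strc_recr].  Both ways to bracket a
    triple product satisfy the same recursion in the entries of the middle
    factor, which ends when that factor is diagonal [strc_assoc].  Coinvariants
    are shown to be a functor by the same recursion [col_multinom_mul]. *)

(** * Finitely supported sums *)

Section FiniteSums.
Context {V : nmodType} {T : choiceType}.

Lemma fsum_exchange (I : finType) (f : I -> T -> V) :
  (forall i, finite_set [set t | f i t != 0]) ->
  \sum_(t \in setT) \sum_i f i t = \sum_i \sum_(t \in setT) f i t.
Proof.
move=> fin.
pose S := [set t | exists i, f i t != 0].
have finS : finite_set S.
  have -> : S = \bigcup_(i in [set: I]) [set t | f i t != 0].
    by apply/seteqP; split=> [t [i ft]|t [i _ ft]]; exists i.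
  by apply: bigcup_finite => //; apply: finite_finset.
have H (g : T -> V) : (forall t, ~ S t -> g t = 0) ->
    \sum_(t \in setT) g t = \sum_(t <- fset_set S) g t.
  move=> g0; rewrite -(fsbig_widen S) ?fsbig_finite // => t /= [_ St].
  exact: g0.
have S0 t : ~ S t -> forall i, f i t = 0.
  move=> St i; apply/eqP; apply: contrapT => /negP ft; apply: St; by exists i.
rewrite H => [|t St]; last by rewrite big1 // => i _; rewrite S0.
rewrite exchange_big; apply: eq_bigr => i _.
by rewrite H // => t St; rewrite S0.
Qed.

End FiniteSums.

(** * Multinomial coefficients with a generic entry *)

Section Multinomials.
Context {F : numFieldType}.

Definition falling (z : F) b : F := \prod_(t < b) (z - t%:R).

Lemma fallingS z b : falling z b.+1 = z * falling (z - 1) b.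
Proof.
rewrite /falling big_ord_recl subr0; congr (_ * _); apply: eq_bigr => t _.
by rewrite /bump /= natrD opprD addrA.
Qed.

Lemma fallingSr z b : falling z b.+1 = falling z b * (z - b%:R).
Proof. by rewrite /falling big_ord_recr. Qed.

(** The polynomial N! / prod_j (a j)!, where N = z + sum_j a j.  If [g] holds then
    the entry at [j0] stands for z + a j0 and its factorial cancels against N!. *)
Definition multinom (g : bool) (j0 : nat) (z : F) n (a : 'I_n -> int) : F :=
  if g then
    (\prod_(j < n | j != j0 :> nat) (absz (a j))`!)%N%:R^-1
      * falling (z + (\sum_j a j)%:~R) (\sum_(j < n | j != j0 :> nat) absz (a j))
  else (\sum_j absz (a j))`!%N%:R / (\prod_j (absz (a j))`!)%N%:R.

Lemma prod_fact_neq0 n (P : pred 'I_n) (f : 'I_n -> nat) :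
  (\prod_(j | P j) (f j)`!)%N%:R != 0 :> F.
Proof.
rewrite pnatr_eq0 -lt0n; apply: prodn_cond_gt0 => j _; exact: fact_gt0.
Qed.

Section Decrement.
Variables (n : nat) (a : 'I_n -> int) (j : 'I_n).
Let a' (i : 'I_n) := a i - (i == j)%:R.

Lemma sum_decr : \sum_i a' i = \sum_i a i - 1.
Proof.
rewrite sumrB (bigD1 j (F := fun i => (i == j)%:R)) //= eqxx.
by congr (_ - _); rewrite big1 ?addr0 // => i /negbTE ->.
Qed.

Lemma decr_other i : i != j -> a' i = a i.
Proof. by move=> /negbTE ij; rewrite /a' ij subr0. Qed.

Lemma sum_absz_decr (P : pred 'I_n) : P j -> 0 < a j ->
  (\sum_(i | P i) absz (a i) = (\sum_(i | P i) absz (a' i)).+1)%N.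
Proof.
move=> Pj aj; rewrite (bigD1 j) // [in RHS](bigD1 j) //= -addSn.
congr (_ + _)%N; last by apply: eq_bigr => i /andP[_ /decr_other ->].
by rewrite /a' eqxx; lia.
Qed.

Lemma prod_fact_decr (P : pred 'I_n) : P j -> 0 < a j ->
  (\prod_(i | P i) (absz (a i))`!
     = absz (a j) * \prod_(i | P i) (absz (a' i))`!)%N.
Proof.
move=> Pj aj; rewrite (bigD1 j) // [in RHS](bigD1 j) //= mulnA.
congr (_ * _)%N; last by apply: eq_bigr => i /andP[_ /decr_other ->].
have -> : absz (a j) = (absz (a' j)).+1 by rewrite /a' eqxx; lia.
by rewrite factS.
Qed.

End Decrement.

(** For natural numbers, both sides count the words of length N with a i letters
    i in which one occurrence of j is marked. *)
Lemma multinom_decr g j0 z n (a : 'I_n -> int) (j : 'I_n) :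
  (~~ g -> z = 0) ->
  (forall i : 'I_n, ~~ (g && (i == j0 :> nat)) -> 0 <= a i) ->
  (~~ (g && (j == j0 :> nat)) -> 0 < a j) ->
  ((if g && (j == j0 :> nat) then z else 0) + (a j)%:~R) * multinom g j0 z a
  = (z + (\sum_i a i)%:~R)
    * multinom g j0 z (fun i => a i - (i == j)%:R).
Proof.
move=> z0 a0 aj0; rewrite /multinom sum_decr.
case: g z0 a0 aj0 => /= z0 a0 aj0; last first.
  have aj := aj0 isT; rewrite z0 // !add0r.
  rewrite (sum_absz_decr _ aj) // (prod_fact_decr _ aj) // factS.
  have -> : (\sum_i a i)%:~R = (\sum_i absz (a i))%N%:R :> F.
    rewrite natr_sum rmorph_sum; apply: eq_bigr => i _ /=.
    by rewrite -[in LHS](gez0_abs (a0 i isT)).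
  rewrite (sum_absz_decr _ aj) // !natrM.
  have -> : (a j)%:~R = (absz (a j))%:R :> F.
    by rewrite -[in LHS](gtz0_abs aj).
  have A0 : (absz (a j))%:R != 0 :> F by rewrite pnatr_eq0; lia.
  have B0 := @prod_fact_neq0 _ xpredT (fun i => absz (a i - (i == j)%:R)).
  by field; rewrite A0 B0.
case: eqP aj0 => [jj0 _|/eqP jj0 /(_ isT) aj]; last first.
  rewrite add0r (sum_absz_decr _ aj) // (prod_fact_decr _ aj) // fallingS.
  have -> : (a j)%:~R = (absz (a j))%:R :> F.
    by rewrite -[in LHS](gtz0_abs aj).
  have A0 : (absz (a j))%:R != 0 :> F by rewrite pnatr_eq0; lia.
  have B0 := @prod_fact_neq0 _ (fun i : 'I_n => i != j0 :> nat)
    (fun i => absz (a i - (i == j)%:R)).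
  rewrite intrD mulrN1z addrA natrM.
  by field; rewrite A0 B0.
have D (i : 'I_n) : i != j0 :> nat -> a i - (i == j)%:R = a i.
  by move=> ij; rewrite (_ : (i == j) = false) ?subr0 // -val_eqE /= jj0 (negbTE ij).
rewrite [in RHS](eq_bigr (fun i => (absz (a i))`!)); last by move=> i /D ->.
rewrite [X in _ = _ * (_ * falling _ X)](eq_bigr (fun i => absz (a i))); last by move=> i /D ->.
set b := (\sum_(i < n | _) absz (a i))%N; set p := _^-1.
set s := \sum_i a i.
have -> : (a j)%:~R = s%:~R - b%:R :> F.
  rewrite /s (bigD1 j) //= rmorphD /= /b natr_sum rmorph_sum /=.
  rewrite [X in _ = _ + X - _](eq_big (fun i : 'I_n => i != j0 :> nat)
    (fun i => (absz (a i))%:R)) ?addrK // => i.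
    by rewrite -val_eqE /= jj0.
  by rewrite -val_eqE /= jj0 => ij; rewrite -[in LHS](gez0_abs (a0 i ij)).
rewrite intrD mulrN1z !addrA.
rewrite [LHS]mulrCA [RHS]mulrCA; congr (_ * _).
by rewrite mulrC -fallingSr fallingS.
Qed.

End Multinomials.

(** * Structure constants and their recursion *)

Section StructureConstants.
Context {F : numFieldType} (x y : F).

Definition special (i k : nat) : bool := (i == k) && (i < 2)%N.

Definition offset (i k : nat) : F :=
  if special i k then if i == 0%N then x else y else 0.

Definition entry_val m n (q : 'M[int]_(m, n)) (i : 'I_m) (k : 'I_n) : F :=
  offset i k + (q i k)%:~R.

Definition special3 (i j k : nat) : bool := [&& i == j, j == k & (i < 2)%N].

Definition tensors l n m (r : 'M[int]_(l, n)) (s : 'M[int]_(n, m))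
    (q : 'M[int]_(l, m)) : set (tensor l n m) :=
  [set A | [/\ (forall (i : 'I_l) (j : 'I_n) (k : 'I_m),
                  ~~ special3 i j k -> 0 <= A (i, j, k)),
               (forall i j, \sum_k A (i, j, k) = r i j),
               (forall i k, \sum_j A (i, j, k) = q i k)
             & (forall j k, \sum_i A (i, j, k) = s j k)]].

Definition weight l n m (A : tensor l n m) : F :=
  \prod_(i < l) \prod_(k < m) multinom (special i k) i (offset i k) (fun j => A (i, j, k)).

(** Defined for arbitrary integer matrices, so that the recursion below, which
    changes row and column sums, makes sense. *)
Definition strc l n m (r : 'M[int]_(l, n)) (s : 'M[int]_(n, m))
    (q : 'M[int]_(l, m)) : F :=
  \sum_(A \in tensors r s q) weight A.

(** The entry of the tensor, including its generic part kappa_1 or kappa_2. *)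
Definition tens_val l n m (A : tensor l n m) (i : 'I_l) (j : 'I_n) (k : 'I_m) : F :=
  (if special i k && (j == i :> nat) then offset i k else 0)
  + (A (i, j, k))%:~R.

Lemma special3E i j k : special3 i j k = special i k && (j == i).
Proof.
rewrite /special3 /special; case: (i =P j) => [<-|/eqP ij] /=.
  by rewrite eqxx andbT.
by rewrite [j == i]eq_sym (negbTE ij) andbF.
Qed.

Definition tshift l n m (A : tensor l n m) (i : 'I_l) (j : 'I_n) (k : 'I_m)
    (d : int) : tensor l n m :=
  [ffun u => A u + (if u == (i, j, k) then d else 0)].

Lemma tshiftK l n m (A : tensor l n m) i j k d :
  tshift (tshift A i j k d) i j k (- d) = A.
Proof. by apply/ffunP => u; rewrite !ffunE; case: ifP => _; rewrite ?addrK ?addr0. Qed.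

Lemma sum_if1 (I : finType) (i : I) (c : int) :
  \sum_j (if j == i then c else 0) = c.
Proof. by rewrite -big_mkcond big_pred1_eq. Qed.

Lemma sum_tshift1 l n m (A : tensor l n m) i j k d i' j' :
  \sum_k' tshift A i j k d (i', j', k')
  = \sum_k' A (i', j', k') + (if (i' == i) && (j' == j) then d else 0).
Proof.
under eq_bigr do rewrite ffunE; rewrite big_split /=; congr (_ + _).
under eq_bigr do rewrite !xpair_eqE.
by case: ifP => _ /=; [rewrite sum_if1 | rewrite big1].
Qed.

Lemma sum_tshift2 l n m (A : tensor l n m) i j k d i' k' :
  \sum_j' tshift A i j k d (i', j', k')
  = \sum_j' A (i', j', k') + (if (i' == i) && (k' == k) then d else 0).
Proof.
under eq_bigr do rewrite ffunE; rewrite big_split /=; congr (_ + _).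
under eq_bigr do rewrite !xpair_eqE andbAC.
by case: ifP => _ /=; [rewrite sum_if1 | rewrite big1].
Qed.

Lemma sum_tshift3 l n m (A : tensor l n m) i j k d j' k' :
  \sum_i' tshift A i j k d (i', j', k')
  = \sum_i' A (i', j', k') + (if (j' == j) && (k' == k) then d else 0).
Proof.
under eq_bigr do rewrite ffunE; rewrite big_split /=; congr (_ + _).
under eq_bigr do rewrite !xpair_eqE -andbA andbC.
by case: ifP => _ /=; [rewrite sum_if1 | rewrite big1].
Qed.

Lemma tens_val_weight l n m (A : tensor l n m) (i : 'I_l) (j : 'I_n) (k : 'I_m) :
  (forall (i : 'I_l) (j : 'I_n) (k : 'I_m), ~~ special3 i j k -> 0 <= A (i, j, k)) ->
  (~~ special3 i j k -> 0 < A (i, j, k)) ->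
  tens_val A i j k * weight A
  = (offset i k + (\sum_j A (i, j, k))%:~R) * weight (tshift A i j k (- 1)).
Proof.
move=> A0 Aijk; rewrite /weight (bigD1 i) //= (bigD1 k) //=.
rewrite [in RHS](bigD1 i) //= [in RHS](bigD1 k) //= !mulrA.
congr (_ * _ * _); last 2 first.
- apply: eq_bigr => k' kk'; congr (multinom _ _ _ _); apply/funext => j'.
  by rewrite ffunE !xpair_eqE (negbTE kk') andbF addr0.
- apply: eq_bigr => i' ii'; apply: eq_bigr => k' _.
  congr (multinom _ _ _ _); apply/funext => j'.
  by rewrite ffunE !xpair_eqE (negbTE ii') addr0.
rewrite /tens_val multinom_decr; last 3 first.
- by move=> /negbTE h; rewrite /offset h.
- by move=> j' h; apply: A0; rewrite special3E.
- by move=> h; apply: Aijk; rewrite special3E.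
congr (_ * multinom _ _ _ _); apply/funext => j'.
rewrite ffunE !xpair_eqE !eqxx /= andbT.
by case: eqP.
Qed.

(** Remove one unit from the entry (i,j,k) of every tensor: by [multinom_decr]
    the summand changes by a factor that depends only on q, and the tensors in
    which there is no unit to remove do not contribute. *)
Lemma strc_shift l n m (r : 'M_(l, n)) (s : 'M_(n, m)) (q : 'M_(l, m))
    (i : 'I_l) (j : 'I_n) (k : 'I_m) :
  \sum_(A \in tensors r s q) tens_val A i j k * weight A
  = entry_val q i k
    * strc (r - delta_mx i j) (s - delta_mx j k) (q - delta_mx i k).
Proof.
pose D := tensors r s q `&` [set A | ~~ special3 i j k -> 0 < A (i, j, k)].
rewrite -(fsbig_widen D); last 2 first.
- by move=> A [].
- move=> A [[A0 Ar Aq As] /= nA]; rewrite /tens_val -special3E.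
  case: ifPn => h; first by exfalso; apply: nA; split; [by split|move=> h'; rewrite h in h'].
  have := A0 i j k h; rewrite le_eqVlt => /orP[/eqP <-|Ap].
    by rewrite addr0 mul0r.
  by exfalso; apply: nA; split; [split|].
rewrite /strc mulr_fsumr.
pose h (A : tensor l n m) := tshift A i j k 1.
rewrite (@reindex_fsbig _ _ _ _ _ h
  (tensors (r - delta_mx i j) (s - delta_mx j k) (q - delta_mx i k))).
  apply: eq_fsbigr => A /set_mem [A0 Ar Aq As].
  rewrite tens_val_weight; last 2 first.
  - move=> i' j' k' h'; rewrite ffunE addr_ge0 ?A0 //; by case: ifP.
  - by move=> h'; rewrite ffunE eqxx ltr_wpDl // A0.
  rewrite tshiftK; congr (_ * _); rewrite /entry_val sum_tshift2 Aq !eqxx /=.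
  by rewrite !mxE !eqxx /= subrK.
split.
- move=> A [A0 Ar Aq As] /=; split; first split.
  + move=> i' j' k' h'; rewrite ffunE addr_ge0 ?A0 //; by case: ifP.
  + move=> i' j'; rewrite sum_tshift1 Ar !mxE; case: ifP => _ /=;
    by rewrite ?subrK ?subr0 ?addr0.
  + move=> i' j'; rewrite sum_tshift2 Aq !mxE; case: ifP => _ /=;
    by rewrite ?subrK ?subr0 ?addr0.
  + move=> i' j'; rewrite sum_tshift3 As !mxE; case: ifP => _ /=;
    by rewrite ?subrK ?subr0 ?addr0.
  + by move=> h'; rewrite ffunE eqxx ltr_wpDl // A0.
- by move=> A B _ _ /(congr1 (fun A => tshift A i j k (-1))); rewrite !tshiftK.
- move=> A [[A0 Ar Aq As] /= Ap]; exists (tshift A i j k (- 1)); last first.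
    by rewrite /h -[1]opprK tshiftK.
  split.
  + move=> i' j' k' h'; rewrite ffunE; case: eqP => [[ei ej ek]|_].
      by subst; have := Ap h'; lia.
    by rewrite addr0 A0.
  + move=> i' j'; rewrite sum_tshift1 Ar !mxE; case: ifP => _ /=;
    by rewrite ?subr0 ?addr0.
  + move=> i' j'; rewrite sum_tshift2 Aq !mxE; case: ifP => _ /=;
    by rewrite ?subr0 ?addr0.
  + move=> i' j'; rewrite sum_tshift3 As !mxE; case: ifP => _ /=;
    by rewrite ?subr0 ?addr0.
Qed.

Definition box (I : finType) (b : nat) : set {ffun I -> int} :=
  [set A | forall u, `|A u| <= b%:Z].

Lemma finite_box (I : finType) b : finite_set (@box I b).
Proof.
pose f (g : {ffun I -> 'I_(b + b).+1}) : {ffun I -> int} :=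
  [ffun u => (g u : nat)%:Z - b%:Z].
apply: (@sub_finite_set _ _ (f @` setT)); last first.
  by apply: finite_image; apply: finite_finset.
move=> A bA; exists [ffun u => inord (absz (A u + b%:Z))] => //.
by apply/ffunP => u; rewrite !ffunE inordK; have := bA u; lia.
Qed.

Lemma le_sum_nonneg (I : finType) (f : I -> int) (i : I) :
  (forall j, 0 <= f j) -> 0 <= f i <= \sum_j f j.
Proof.
move=> f0; rewrite f0 /= (bigD1 i) //= lerDl; exact: sumr_ge0.
Qed.

Definition tensors_rs l n m (r : 'M[int]_(l, n)) (s : 'M[int]_(n, m)) :
    set (tensor l n m) :=
  [set A | exists q, tensors r s q A].

(** At least one of the pairs (i,j) and (j,k) is not generic, and the row or
    column sum at that pair has nonnegative terms only. *)
Lemma tensors_bound l n m (r : 'M[int]_(l, n)) (s : 'M[int]_(n, m)) q A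
    (i : 'I_l) (j : 'I_n) (k : 'I_m) :
  tensors r s q A -> ~~ special3 i j k ->
  `|A (i, j, k)| <= `|r i j| + `|s j k|.
Proof.
move=> [A0 Ar Aq As] h.
have [ij|ij] := boolP (special i j).
  have jk : ~~ special j k.
    by move: h ij; rewrite /special3 /special; case: eqP => //= ->;
      case: (j =P k :> nat) => //=; case: ltnP.
  have := le_sum_nonneg i (f := fun i => A (i, j, k)); rewrite As => H.
  have {}H : 0 <= A (i, j, k) <= s j k.
    apply: H => i'; apply: A0; move: jk; rewrite /special3 /special.
    by case: (i' =P j :> nat) => //= ->.
  by lia.
have := le_sum_nonneg k (f := fun k => A (i, j, k)); rewrite Ar => H.
have {}H : 0 <= A (i, j, k) <= r i j.
  apply: H => k'; apply: A0; move: ij; rewrite /special3 /special.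
  by case: (i =P j :> nat) => //= _; case: ltnP; rewrite ?andbF.
by lia.
Qed.

Lemma finite_tensors_rs l n m (r : 'M[int]_(l, n)) (s : 'M[int]_(n, m)) :
  finite_set (tensors_rs r s).
Proof.
pose b := (\sum_i \sum_j absz (r i j) + \sum_i \sum_j absz (s i j))%N.
have rb i j : `|r i j| <= (\sum_i \sum_j absz (r i j))%N%:Z.
  rewrite (bigD1 i) //= (bigD1 j) //=; lia.
have sb i j : `|s i j| <= (\sum_i \sum_j absz (s i j))%N%:Z.
  rewrite (bigD1 i) //= (bigD1 j) //=; lia.
apply: sub_finite_set (finite_box _ (b + m * b)) => A [q Aq] [[i j] k] /=.
have bnd (k' : 'I_m) : ~~ special3 i j k' -> `|A (i, j, k')| <= b%:Z.
  move=> h; apply: le_trans (tensors_bound Aq h) _.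
  by have := rb i j; have := sb j k'; rewrite /b; lia.
have [h|/bnd H] := boolP (special3 i j k); last first.
  by apply: le_trans H _; rewrite PoszD lerDl.
have [_ Ar _ _] := Aq.
have E : A (i, j, k) = r i j - \sum_(k' | k' != k) A (i, j, k').
  by rewrite -Ar (bigD1 k) //= addrK.
have S : `|\sum_(k' | k' != k) A (i, j, k')| <= (m * b)%:Z.
  apply: le_trans (ler_norm_sum _ _ _) _.
  apply: (@le_trans _ _ (\sum_(k' < m) b%:Z)); last first.
    by rewrite sumr_const card_ord -mulr_natl natz PoszM.
  rewrite [leRHS](bigD1 k) //=; apply: le_trans (_ : \sum_(k' < m | k' != k) b%:Z <= _).
    apply: ler_sum => k' kk'; apply: bnd; apply: contra kk'.
    move: h; rewrite /special3 -val_eqE => /and3P[/eqP -> /eqP -> _].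
    by rewrite eq_sym => /and3P[].
  by rewrite lerDr.
rewrite E; apply: le_trans (ler_normB _ _) _.
by have := rb i j; rewrite /b PoszD; lia.
Qed.

Lemma finite_tensors l n m (r : 'M[int]_(l, n)) (s : 'M[int]_(n, m)) q :
  finite_set (tensors r s q).
Proof. by apply: sub_finite_set (finite_tensors_rs r s) => A Aq; exists q. Qed.

Lemma tensors_sum l n m (r : 'M[int]_(l, n)) (s : 'M[int]_(n, m)) q
    (f : tensor l n m -> F) :
  \sum_(A \in tensors r s q) f A
  = \sum_(A <- fset_set (tensors r s q)) f A.
Proof. by rewrite fsbig_finite //; apply: finite_tensors. Qed.

Lemma strc_neq0 l n m (r : 'M[int]_(l, n)) (s : 'M[int]_(n, m)) q :
  strc r s q != 0 -> exists A, tensors r s q A.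
Proof.
move=> c0; apply: contrapT => /forallNP nA; move/eqP: c0; apply.
by rewrite /strc fsbig1 // => A /nA.
Qed.

Lemma strc_finite l n m (r : 'M[int]_(l, n)) (s : 'M[int]_(n, m)) :
  finite_set [set q | strc r s q != 0].
Proof.
pose f (A : tensor l n m) : 'M[int]_(l, m) := \matrix_(i, k) \sum_j A (i, j, k).
apply: sub_finite_set (finite_image f (finite_tensors_rs r s)) => q.
case/strc_neq0=> A Aq; exists A; first by exists q.
by case: Aq => _ _ Aq _; apply/matrixP => i k; rewrite mxE Aq.
Qed.

(** Sum [strc_shift] over k: the entries of A at (i,j,k) add up to r_ij. *)
Lemma strc_recl l n m (r : 'M_(l, n)) (s : 'M_(n, m.+2)) (q : 'M_(l, m.+2)) (i : 'I_l) (j : 'I_n) :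
  entry_val r i j * strc r s q
  = \sum_k entry_val q i k
      * strc (r - delta_mx i j) (s - delta_mx j k) (q - delta_mx i k).
Proof.
under [RHS]eq_bigr do rewrite -strc_shift tensors_sum.
rewrite exchange_big /strc tensors_sum mulr_sumr /=.
apply: eq_big_seq => A; rewrite in_fset_set; last exact: finite_tensors.
move=> /set_mem [_ Ar _ _]; rewrite -mulr_suml; congr (_ * _).
rewrite /tens_val big_split /= /entry_val -Ar rmorph_sum; congr (_ + _).
under eq_bigr do rewrite -special3E.
have [/andP[ij i2]|ij] := boolP (special i j); last first.
  rewrite /offset (negbTE ij) big1 // => k _; case: ifP => //.
  by case/and3P => e _ i2; move: ij; rewrite /special e i2.
have i2' : (i < m.+2)%N by apply: leq_trans i2 _.
rewrite (bigD1 (Ordinal i2')) //= big1 ?addr0 => [|k ki].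
  by rewrite /special3 -(eqP ij) eqxx i2.
rewrite /special3 -(eqP ij) eqxx i2 andbT /= eq_sym.
by move: ki; rewrite -val_eqE /= => /negbTE ->.
Qed.

Lemma strc_recr l n m (r : 'M_(l.+2, n)) (s : 'M_(n, m)) (q : 'M_(l.+2, m)) (j : 'I_n) (k : 'I_m) :
  entry_val s j k * strc r s q
  = \sum_i entry_val q i k
      * strc (r - delta_mx i j) (s - delta_mx j k) (q - delta_mx i k).
Proof.
under [RHS]eq_bigr do rewrite -strc_shift tensors_sum.
rewrite exchange_big /strc tensors_sum mulr_sumr /=.
apply: eq_big_seq => A; rewrite in_fset_set; last exact: finite_tensors.
move=> /set_mem [_ _ _ As]; rewrite -mulr_suml; congr (_ * _).
rewrite /tens_val big_split /= /entry_val -As rmorph_sum; congr (_ + _).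
under eq_bigr do rewrite -special3E.
have [/andP[jk j2]|jk] := boolP (special j k); last first.
  rewrite /offset (negbTE jk) big1 // => i _; case: ifP => //.
  by case/and3P => /eqP -> e j2; move: jk; rewrite /special e j2.
have j2' : (j < l.+2)%N by apply: leq_trans j2 _.
rewrite (bigD1 (Ordinal j2')) //= big1 ?addr0 => [|i ij].
  by rewrite /special3 -(eqP jk) eqxx j2 /=.
rewrite /special3 (_ : (i == j :> nat) = false) //.
by move: ij; rewrite -val_eqE /= => /negbTE ->.
Qed.

End StructureConstants.

(** * Associativity *)

Section Associativity.
Context {F : numFieldType} (x y : F).
Local Notation strc := (strc x y).
Local Notation weight := (weight x y).
Local Notation entry_val := (entry_val x y).

Lemma sum0_nonneg (I : finType) (f : I -> int) (i : I) :
  \sum_j f j = 0 -> (forall j, 0 <= f j) -> f i = 0.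
Proof.
by move=> s0 f0; apply/eqP; rewrite eq_le f0 andbT -s0; case/andP: (le_sum_nonneg i f0).
Qed.

(** Transposition exchanges the two factors, which halves the work below. *)
Lemma tensors_tr l n m (r : 'M_(l, n)) (s : 'M_(n, m)) q A :
  tensors r s q A ->
  tensors s^T r^T q^T [ffun u : 'I_m * 'I_n * 'I_l => A (u.2, u.1.2, u.1.1)].
Proof.
case=> A0 Ar Aq As; split=> [i j k h|i j|i k|j k].
- rewrite ffunE; apply: A0; apply: contra h => /and3P[/eqP kj /eqP ji k2].
  by rewrite /special3 -ji -kj !eqxx.
- by rewrite mxE -As; apply: eq_bigr => k _; rewrite ffunE.
- by rewrite mxE -Aq; apply: eq_bigr => j _; rewrite ffunE.
- by rewrite mxE -Ar; apply: eq_bigr => i _; rewrite ffunE.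
Qed.

Lemma strc_tr l n m (r : 'M_(l, n)) (s : 'M_(n, m)) q :
  strc s^T r^T q^T = strc r s q.
Proof.
pose h (A : tensor l n m) : tensor m n l :=
  [ffun u : 'I_m * 'I_n * 'I_l => A (u.2, u.1.2, u.1.1)].
pose h' (A : tensor m n l) : tensor l n m :=
  [ffun u : 'I_l * 'I_n * 'I_m => A (u.2, u.1.2, u.1.1)].
have hK : cancel h h' by move=> A; apply/ffunP => -[[i j] k]; rewrite !ffunE.
have h'K : cancel h' h by move=> A; apply/ffunP => -[[i j] k]; rewrite !ffunE.
rewrite /strc (@reindex_fsbig _ _ _ _ _ h (tensors r s q)).
  apply: eq_fsbigr => A _; rewrite /weight exchange_big /=.
  apply: eq_bigr => i _; apply: eq_bigr => k _.
  rewrite (_ : (fun j => _) = (fun j => A (i, j, k))); last first.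
    by apply/funext => j; rewrite ffunE.
  rewrite /offset /special eq_sym; case: eqP => [->//|_] /=.
  by rewrite /multinom.
split=> [A|A A' _ _ /(can_inj hK)//|A As]; first exact: tensors_tr.
exists (h' A) => //; have := tensors_tr As; rewrite !trmxK; exact.
Qed.

Definition Tnonneg n m (q : 'M[int]_(n, m)) : Prop :=
  forall (i : 'I_n) (k : 'I_m), ~~ special i k -> 0 <= q i k.

Lemma strc_rows12 l n m (r : 'M_(l, n)) (s : 'M_(n, m)) q :
  strc r s q != 0 -> forall j, \sum_i r i j = \sum_k s j k.
Proof.
case/strc_neq0=> A [_ Ar _ As] j.
by under eq_bigr do rewrite -Ar; under [RHS]eq_bigr do rewrite -As; rewrite exchange_big.
Qed.

Lemma strc_rows13 l n m (r : 'M_(l, n)) (s : 'M_(n, m)) q :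
  strc r s q != 0 -> forall i, \sum_j r i j = \sum_k q i k.
Proof.
case/strc_neq0=> A [_ Ar Aq _] j.
by under eq_bigr do rewrite -Ar; under [RHS]eq_bigr do rewrite -Aq; rewrite exchange_big.
Qed.

Lemma strc_rows23 l n m (r : 'M_(l, n)) (s : 'M_(n, m)) q :
  strc r s q != 0 -> forall k, \sum_j s j k = \sum_i q i k.
Proof.
case/strc_neq0=> A [_ _ Aq As] j.
by under eq_bigr do rewrite -As; under [RHS]eq_bigr do rewrite -Aq; rewrite exchange_big.
Qed.

Lemma strc_nonneg1 l n m (r : 'M_(l, n)) (s : 'M_(n, m)) q :
  strc r s q != 0 -> Tnonneg r.
Proof.
case/strc_neq0=> A [A0 Ar Aq As] i j h; rewrite -Ar; apply: sumr_ge0 => k _.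
by apply: A0; apply: contra h => /and3P[h1 _ h2]; rewrite /special h1.
Qed.

Lemma strc_nonneg2 l n m (r : 'M_(l, n)) (s : 'M_(n, m)) q :
  strc r s q != 0 -> Tnonneg s.
Proof.
rewrite -strc_tr => /strc_nonneg1 h j k jk; have := h k j.
by rewrite mxE; apply; apply: contra jk; rewrite /special => /andP[/eqP ->]; rewrite eqxx.
Qed.

Lemma strc_nonneg3 l n m (r : 'M_(l, n)) (s : 'M_(n, m)) q :
  strc r s q != 0 -> Tnonneg q.
Proof.
case/strc_neq0=> A [A0 Ar Aq As] i k h; rewrite -Aq; apply: sumr_ge0 => j _.
by apply: A0; apply: contra h => /and3P[h1 h2 h3]; rewrite /special (eqP h1) h2 -(eqP h1).
Qed.

(** Rows beyond the last one are zero, so that matrices with different numbers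
    of rows can be compared. *)
Definition rowx n m (s : 'M[int]_(n, m)) (j : nat) (k : 'I_m) : int :=
  oapp (fun j' : 'I_n => s j' k) 0 (insub j).

Lemma rowxE n m (s : 'M[int]_(n, m)) (j : 'I_n) k : rowx s j k = s j k.
Proof. by rewrite /rowx valK. Qed.

Lemma rowx_out n m (s : 'M[int]_(n, m)) (j : nat) k :
  (n <= j)%N -> rowx s j k = 0.
Proof. by move=> nj; rewrite /rowx insubF // ltnNge nj. Qed.

Definition is_diag n m (r : 'M[int]_(n, m)) : Prop :=
  forall (i : 'I_n) (j : 'I_m), i != j :> nat -> r i j = 0.

Lemma multinom_single g j0 z n (a : 'I_n -> int) :
  (forall j : 'I_n, j != j0 :> nat -> a j = 0) -> multinom g j0 z a = 1 :> F.
Proof.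
move=> a0; rewrite /multinom.
have P : (\prod_(j < n | j != j0 :> nat) (absz (a j))`! = 1)%N.
  by apply: big1 => j /a0 ->.
have S : (\sum_(j < n | j != j0 :> nat) absz (a j) = 0)%N.
  by apply: big1 => j /a0 ->.
case: g; first by rewrite P S invr1 mul1r /falling big_ord0.
rewrite (bigID (fun j : 'I_n => j != j0 :> nat)) /= S add0n.
rewrite [in X in _ / X](bigID (fun j : 'I_n => j != j0 :> nat)) /= P mul1n.
case: (ltnP j0 n) => j0n; last first.
  rewrite !big_pred0 ?divr1 // => j; rewrite negbK;
    by apply/eqP => jj0; have := ltn_ord j; rewrite jj0 ltnNge j0n.
have E : (fun j : 'I_n => ~~ (j != j0 :> nat)) =1 pred1 (Ordinal j0n).
  by move=> j; rewrite negbK.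
rewrite !(big_pred1 _ E) divff // pnatr_eq0 -lt0n; exact: fact_gt0.
Qed.

Lemma tensors_diagl l n m (r : 'M_(l, n)) (s : 'M_(n, m)) q A :
  is_diag r -> tensors r s q A ->
  (forall (i : 'I_l) (j : 'I_n) (k : 'I_m), A (i, j, k) = if i == j :> nat then s j k else 0)
  /\ (forall i k, rowx s i k = rowx q i k).
Proof.
move=> rd [A0 Ar Aq As].
have Aoff (i : 'I_l) (j : 'I_n) (k : 'I_m) : i != j :> nat -> A (i, j, k) = 0.
  move=> ij; have := Ar i j; rewrite rd //.
  have P k' : 0 <= A (i, j, k') by apply: A0; rewrite /special3 (negbTE ij).
  by move/sum0_nonneg; apply.
have AE (i : 'I_l) (j : 'I_n) (k : 'I_m) : A (i, j, k) = if i == j :> nat then s j k else 0.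
  case: ifPn => [ij|]; last exact: Aoff.
  rewrite -As (bigD1 i) //= big1 ?addr0 // => i' ii'; apply: Aoff.
  by rewrite -(eqP ij).
split=> // i k.
case: (ltnP i l) => il; case: (ltnP i n) => jn.
- rewrite (rowxE s (Ordinal jn)) (rowxE q (Ordinal il)) -Aq.
  rewrite (bigD1 (Ordinal jn)) //= AE /= eqxx big1 ?addr0 // => j ji.
  by rewrite AE ifF //; apply: contraNF ji; rewrite -val_eqE eq_sym.
- rewrite (rowx_out _ _ jn) (rowxE q (Ordinal il)) -Aq big1 // => j _.
  by rewrite Aoff // neq_ltn /= orbC (leq_trans (ltn_ord j)).
- rewrite (rowx_out _ _ il) (rowxE s (Ordinal jn)) -As big1 // => j _.
  by rewrite Aoff // neq_ltn /= (leq_trans (ltn_ord j)).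
- by rewrite !rowx_out.
Qed.

Lemma strc_diagl_tensors l n m (r : 'M_(l, n)) (s : 'M_(n, m)) q A :
  is_diag r -> tensors r s q A -> strc r s q = 1.
Proof.
move=> rd TA; have [AE _] := tensors_diagl rd TA.
rewrite /strc (_ : tensors r s q = [set A]) ?fsbig_set1.
  apply: big1 => i _; apply: big1 => k _; apply: multinom_single => j ji.
  by rewrite AE eq_sym (negbTE ji).
apply/seteqP; split=> [B TB|B -> //]; have [BE _] := tensors_diagl rd TB.
by apply/ffunP => -[[i j] k]; rewrite AE BE.
Qed.

(** If r is diagonal then the only tensor is A_ijk = s_jk for i = j, with weight
    1, and it gives q = s up to rows of zeros. *)
Lemma strc_diagl_neq0 l n m (r : 'M_(l, n)) (s : 'M_(n, m)) q :
  is_diag r -> strc r s q != 0 ->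
  strc r s q = 1 /\ forall i k, rowx s i k = rowx q i k.
Proof.
move=> rd /strc_neq0[A TA]; split; first exact: strc_diagl_tensors TA.
by case: (tensors_diagl rd TA).
Qed.

Lemma strc_diagl l n m (r : 'M_(l, n)) (s : 'M_(n, m)) q :
  is_diag r -> Tnonneg s ->
  (forall (i : 'I_l) (j : 'I_n), i = j :> nat -> r i j = \sum_k s j k) ->
  (forall i k, rowx s i k = rowx q i k) ->
  strc r s q = 1.
Proof.
move=> rd s0 rs sq.
apply: (@strc_diagl_tensors _ _ _ _ _ _ [ffun u : 'I_l * 'I_n * 'I_m =>
  if u.1.1 == u.1.2 :> nat then s u.1.2 u.2 else 0]) => //.
split=> [i j k h|i j|i k|j k]; rewrite ?ffunE /=.
- case: ifP => // ij; apply: s0; apply: contra h => /andP[jk j2].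
  by rewrite /special3 ij jk (eqP ij).
- under eq_bigr do rewrite ffunE /=.
  by case: eqP => [/rs ->//|/eqP ij]; rewrite rd // big1.
- under eq_bigr do rewrite ffunE /=.
  rewrite -[RHS]rowxE -sq; case: (ltnP i n) => jn; last first.
    rewrite rowx_out // big1 // => j _; case: eqP => // ij.
    by have := ltn_ord j; rewrite -ij ltnNge jn.
  rewrite (rowxE s (Ordinal jn)) (bigD1 (Ordinal jn)) //= eqxx big1 ?addr0 // => j ji.
  by rewrite ifF //; apply: contraNF ji; rewrite -val_eqE eq_sym.
- under eq_bigr do rewrite ffunE /=.
  case: (ltnP j l) => jl; last first.
    rewrite -[RHS]rowxE sq rowx_out // big1 // => i _; case: eqP => // ij.
    by have := ltn_ord i; rewrite ij ltnNge jl.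
  rewrite (bigD1 (Ordinal jl)) //= eqxx big1 ?addr0 // => i ji.
  by rewrite ifF //; apply: contraNF ji; rewrite -val_eqE.
Qed.

Lemma big_extend (R : Type) (idx : R) (op : Monoid.com_law idx) n n'
    (P : pred nat) (f : 'I_n -> R) : (n <= n')%N ->
  \big[op/idx]_(j < n' | P j) oapp f idx (insub (j : nat))
  = \big[op/idx]_(j < n | P j) f j.
Proof.
move=> nn'.
transitivity (\big[op/idx]_(j < n | P j) oapp f idx (insub (j : nat))); last first.
  by apply: eq_bigr => j _; rewrite valK.
rewrite (big_ord_widen_cond _ P (fun j => oapp f idx (insub j)) nn').
rewrite (bigID (fun j : 'I_n' => (j < n)%N)) /= [X in op _ X]big1 ?Monoid.mulm1 //.
by move=> j /andP[_ jn]; rewrite insubF // (negbTE jn).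
Qed.

Lemma multinom_extend g j0 z n n' (a : 'I_n -> int) : (n <= n')%N ->
  multinom g j0 z (fun j : 'I_n' => oapp a 0 (insub (j : nat)))
  = multinom g j0 z a :> F.
Proof.
move=> nn'; rewrite /multinom.
have E1 (j : 'I_n') : absz (oapp a 0 (insub (j : nat)))
    = oapp (fun j => absz (a j)) 0%N (insub (j : nat)) by case: insub.
have E2 (j : 'I_n') : (absz (oapp a 0 (insub (j : nat))))`!
    = oapp (fun j => (absz (a j))`!) 1%N (insub (j : nat)) by case: insub.
rewrite !(eq_bigr _ (fun i _ => E1 i)) !(eq_bigr _ (fun i _ => E2 i)).
by rewrite (big_extend _ xpredT) // !(big_extend _ (fun j => j != j0)) //
  !(big_extend _ xpredT).
Qed.

(** A tensor is supported where its margins are, so zero columns of the left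
    factor and zero rows of the right one do not matter. *)
Lemma strc_extend l n n' m (t : 'M_(l, n.+2)) (v : 'M_(n.+2, m))
    (u : 'M_(l, n'.+2)) (s : 'M_(n'.+2, m)) p : (n <= n')%N ->
  (forall i h, rowx t^T i h = rowx u^T i h) ->
  (forall i k, rowx v i k = rowx s i k) ->
  strc t v p = strc u s p.
Proof.
move=> nn' tu vs.
pose h (A : tensor l n.+2 m) : tensor l n'.+2 m :=
  [ffun w : 'I_l * 'I_n'.+2 * 'I_m =>
     oapp (fun j => A (w.1.1, j, w.2)) 0 (insub (w.1.2 : nat))].
have hE A i j k : h A (i, j, k) = oapp (fun j => A (i, j, k)) 0 (insub (j : nat)).
  by rewrite ffunE.
have hin A i (j : 'I_n.+2) (j' : 'I_n'.+2) k : j = j' :> nat -> h A (i, j', k) = A (i, j, k).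
  by move=> jj'; rewrite hE -jj' valK.
have uE i (j : 'I_n'.+2) : u i j = rowx t^T j i by rewrite tu rowxE mxE.
have sE (j : 'I_n'.+2) k : s j k = rowx v j k by rewrite vs rowxE.
symmetry; rewrite /strc (@reindex_fsbig _ _ _ _ _ h (tensors t v p)).
  apply: eq_fsbigr => A _; apply: eq_bigr => i _; apply: eq_bigr => k _.
  rewrite -[RHS](multinom_extend _ _ _ (n' := n'.+2)) //.
  by congr (multinom _ _ _ _); apply/funext => j; rewrite hE.
split.
- move=> A [A0 At Ap Av]; split=> [i j k h0|i j|i k|j k].
  + rewrite hE; case: insubP => //= j0 _ jj0; apply: A0.
    by rewrite /special3 jj0.
  + rewrite uE /rowx; under eq_bigr do rewrite hE.
    by case: insubP => [j0 _ jj0|_] /=; rewrite ?mxE -?At // big1.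
  + under eq_bigr do rewrite hE.
    by rewrite -Ap (big_extend _ xpredT).
  + rewrite sE /rowx; under eq_bigr do rewrite hE.
    by case: insubP => [j0 _ jj0|_] /=; rewrite ?mxE -?Av // big1.
- move=> A A' _ _ AA'; apply/ffunP => -[[i j] k].
  have jn' : (j < n'.+2)%N by apply: leq_trans (ltn_ord j) _.
  by rewrite -(hin A i j (Ordinal jn') k) // AA' (hin A' i j (Ordinal jn') k).
- move=> A [A0 Au Ap As].
  pose A' : tensor l n.+2 m := [ffun w : 'I_l * 'I_n.+2 * 'I_m =>
    A (w.1.1, inord w.1.2, w.2)].
  have hA' : h A' = A.
    apply/ffunP => -[[i j] k]; rewrite hE; case: insubP => [j0 _ jj0|jn] /=.
      by rewrite ffunE /= jj0 inord_val.
    have P k' : 0 <= A (i, j, k').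
      apply: A0; rewrite /special3; apply/negP => /and3P[/eqP ij _ i2].
      by move: jn; rewrite -ij (leq_trans i2).
    symmetry; apply: (sum0_nonneg (f := fun k => A (i, j, k))) => //.
    by rewrite Au uE rowx_out // leqNgt.
  exists A' => //.
  have A'E i (j : 'I_n.+2) k : A' (i, j, k) = A (i, inord j, k) by rewrite ffunE.
  have iv (j : 'I_n.+2) : (inord j : 'I_n'.+2) = j :> nat.
    by rewrite inordK //; apply: leq_trans (ltn_ord j) _.
  split=> [i j k h0|i j|i k|j k].
  + by rewrite A'E; apply: A0; rewrite /special3 iv.
  + by under eq_bigr do rewrite A'E; rewrite Au uE iv rowxE mxE.
  + rewrite -Ap -hA'; under [RHS]eq_bigr do rewrite hE.
    by rewrite (big_extend _ xpredT).
  + by under eq_bigr do rewrite A'E; rewrite As sE iv rowxE.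
Qed.

Definition assocl l n m k (t : 'M_(l, n)) (r : 'M_(n, m)) (s : 'M_(m, k)) p : F :=
  \sum_(u \in setT) strc t r u * strc u s p.
Definition assocr l n m k (t : 'M_(l, n)) (r : 'M_(n, m)) (s : 'M_(m, k)) p : F :=
  \sum_(v \in setT) strc r s v * strc t v p.

Lemma assocr_tr l n m k (t : 'M_(l, n)) (r : 'M_(n, m)) (s : 'M_(m, k)) p :
  assocl s^T r^T t^T p^T = assocr t r s p.
Proof.
rewrite /assocr /assocl (@reindex_fsbigT _ _ _ _ _ trmx); last first.
  by exists trmx => q; rewrite trmxK.
by apply: eq_fsbigr => v _; rewrite !strc_tr.
Qed.

Lemma finite_strcl l n m (I : finType) (c : I -> F) (f : I -> 'M_(l, m) -> F)
    (t : I -> 'M_(l, n)) (r : I -> 'M_(n, m)) (d : I -> 'M_(l, m)) i :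
  finite_set [set u | c i * strc (t i) (r i) (u - d i) * f i u != 0].
Proof.
apply: sub_finite_set (finite_image (+%R^~ (d i)) (strc_finite x y (t i) (r i))).
move=> u /=; rewrite !mulf_eq0 !negb_or => /andP[/andP[_ h] _].
by exists (u - d i); rewrite ?subrK.
Qed.

Lemma fsum_translate l m (f : 'M[int]_(l, m) -> F) d :
  \sum_(u \in setT) f (u - d) = \sum_(u \in setT) f u.
Proof.
rewrite [RHS](@reindex_fsbigT _ _ _ _ _ (+%R^~ (- d))) //.
by exists (+%R^~ d) => u; rewrite ?subrK ?addrK.
Qed.

(** Apply [strc_recr] to r as right factor of t r, and then [strc_recl] to the
    entry of u = t r that was produced. *)
Lemma assocl_rec l n m k (t : 'M_(l.+2, n)) (r : 'M_(n, m)) (s : 'M_(m, k.+2)) p i j :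
  entry_val r i j * assocl t r s p
  = \sum_h \sum_g entry_val p h g
     * assocl (t - delta_mx h i) (r - delta_mx i j) (s - delta_mx j g) (p - delta_mx h g).
Proof.
rewrite /assocl mulr_fsumr.
transitivity (\sum_(u \in setT) \sum_h \sum_g entry_val p h g
   * strc (t - delta_mx h i) (r - delta_mx i j) (u - delta_mx h j)
   * strc (u - delta_mx h j) (s - delta_mx j g) (p - delta_mx h g)).
  apply: eq_fsbigr => u _; rewrite mulrA strc_recr mulr_suml.
  apply: eq_bigr => h _; rewrite mulrAC strc_recl mulr_suml.
  by apply: eq_bigr => g _; rewrite mulrAC -mulrA mulrCA !mulrA.
under eq_fsbigr do rewrite pair_big /=.
rewrite fsum_exchange => [|[h g]]; last first.
  exact: (@finite_strcl _ _ _ _ (fun w : 'I_l.+2 * 'I_k.+2 => entry_val p w.1 w.2)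
    (fun w u => strc (u - delta_mx w.1 j) (s - delta_mx j w.2) (p - delta_mx w.1 w.2))
    (fun w => t - delta_mx w.1 i) (fun w => r - delta_mx i j)
    (fun w => delta_mx w.1 j) (h, g)).
rewrite pair_big; apply: eq_bigr => -[h g] _ /=.
rewrite mulr_fsumr (fsum_translate (fun u => entry_val p h g
   * strc (t - delta_mx h i) (r - delta_mx i j) u
   * strc u (s - delta_mx j g) (p - delta_mx h g)) (delta_mx h j)).
by apply: eq_fsbigr => u _; rewrite mulrA.
Qed.

Lemma entry_val_tr n m (r : 'M[int]_(n, m)) i j :
  entry_val r^T j i = entry_val r i j.
Proof.
by rewrite /entry_val mxE /offset /special eq_sym; case: eqP => // ->.
Qed.

Lemma assocr_rec l n m k (t : 'M_(l.+2, n)) (r : 'M_(n, m)) (s : 'M_(m, k.+2)) p i j :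
  entry_val r i j * assocr t r s p
  = \sum_h \sum_g entry_val p h g
     * assocr (t - delta_mx h i) (r - delta_mx i j) (s - delta_mx j g) (p - delta_mx h g).
Proof.
rewrite -assocr_tr -entry_val_tr assocl_rec exchange_big /=.
apply: eq_bigr => h _; apply: eq_bigr => g _; rewrite entry_val_tr -assocr_tr.
by rewrite !linearB /= !trmx_delta.
Qed.

(** The base of the induction.  For diagonal r both sums reduce to one term; the
    surviving u and v differ from t and s by zero columns and rows only. *)
Lemma assoc_diag l n m k (t : 'M_(l, n.+2)) (r : 'M_(n.+2, m.+2))
    (s : 'M_(m.+2, k)) p :
  is_diag r -> assocl t r s p != 0 -> assocl t r s p = assocr t r s p.
Proof.
move=> rd L0.
have [u tu us] : exists2 u, strc t r u != 0 & strc u s p != 0.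
  apply: contrapT => nu; move/eqP: L0; apply; rewrite /assocl fsbig1 // => u _.
  apply/eqP; rewrite mulf_eq0 -[_ || _]negbK negb_or; apply/negP => /andP[h1 h2].
  by apply: nu; exists u.
have rdT : is_diag r^T by move=> i j ij; rewrite mxE rd // eq_sym.
have tr1 u' : strc t r u' != 0 ->
    strc t r u' = 1 /\ forall i h, rowx t^T i h = rowx u'^T i h.
  by rewrite -strc_tr => /(strc_diagl_neq0 rdT).
have [c1 tuE] := tr1 u tu.
have LE : assocl t r s p = strc u s p.
  rewrite /assocl -(fsbig_widen [set u]) // ?fsbig_set1 ?c1 ?mul1r //.
  move=> u' [_ /= uu']; case: (eqVneq (strc t r u') 0) => [->|]; first by rewrite mul0r.
  case/tr1=> _ tu'; case: uu'; apply/matrixP => h j.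
  by have := tu' j h; rewrite tuE !rowxE !mxE.
pose v : 'M_(n.+2, k) := \matrix_(i, g) rowx s i g.
have s0 := strc_nonneg2 us.
have vs i g : rowx s i g = rowx v i g.
  case: (ltnP i n.+2) => ni; first by rewrite (rowxE v (Ordinal ni)) mxE.
  rewrite [RHS]rowx_out //; case: (ltnP i m.+2) => mi; last by rewrite rowx_out.
  rewrite (rowxE s (Ordinal mi)).
  have P g' : 0 <= s (Ordinal mi) g'.
    by apply: s0; rewrite /special /= [(i < 2)%N]ltnNge (leq_trans _ ni) ?andbF.
  apply: (sum0_nonneg (f := s (Ordinal mi))) P; rewrite -(strc_rows12 us) big1 // => h _.
  by have := tuE i h; rewrite rowx_out // (rowxE u^T (Ordinal mi)) mxE.
have c2 : strc r s v = 1.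
  apply: strc_diagl => // i j ij; rewrite -(strc_rows12 us) -(strc_rows23 tu).
  by rewrite (bigD1 i) //= big1 ?addr0 // => i' ii'; rewrite rd // -ij.
have RE : assocr t r s p = strc t v p.
  rewrite /assocr -(fsbig_widen [set v]) // ?fsbig_set1 ?c2 ?mul1r //.
  move=> v' [_ /= vv']; case: (eqVneq (strc r s v') 0) => [->|]; first by rewrite mul0r.
  case/(strc_diagl_neq0 rd)=> _ sv'; case: vv'; apply/matrixP => i g.
  by have := sv' i g; rewrite vs !rowxE.
rewrite LE RE; case/orP: (leq_total n m) => nm.
  by symmetry; apply: strc_extend.
by apply: strc_extend.
Qed.

Lemma entry_val_off n m (r : 'M[int]_(n, m)) (i : 'I_n) (j : 'I_m) :
  i != j :> nat -> entry_val r i j = (r i j)%:~R.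
Proof. by move=> ij; rewrite /entry_val /offset /special (negbTE ij) add0r. Qed.

(** Induction on the sum of the off-diagonal entries of r: a nonzero one is
    positive, hence invertible, and both sides satisfy the same recursion. *)
Theorem strc_assoc l n m k (t : 'M_(l.+2, n.+2)) (r : 'M_(n.+2, m.+2))
    (s : 'M_(m.+2, k.+2)) p :
  assocl t r s p = assocr t r s p.
Proof.
have [N] := ubnP (\sum_(i < n.+2) \sum_(j < m.+2 | i != j :> nat) absz (r i j))%N.
elim: N => // N IH in t r s p * => rN.
case: (pselect (is_diag r)) => [rd|nd].
  case: (eqVneq (assocl t r s p) 0) => [L0|]; last exact: assoc_diag.
  case: (eqVneq (assocr t r s p) 0) => [->//|].
  rewrite -assocr_tr => R0; rewrite (assoc_diag _ R0) -?assocr_tr ?trmxK //.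
  by move=> i j ij; rewrite mxE rd // eq_sym.
have [i [j [ij rij]]] : exists (i : 'I_n.+2) (j : 'I_m.+2), i != j :> nat /\ r i j != 0.
  apply: contrapT => h; apply: nd => i j ij; apply/eqP/negPn/negP => rij.
  by apply: h; exists i, j.
have [r0|r0] := leP 0 (r i j); last first.
  have Z l' m' (a : 'M_(l', n.+2)) (b : 'M_(m.+2, m')) u v :
      strc a r u = 0 /\ strc r b v = 0.
    split; apply/eqP; apply: contraTT r0 => h; rewrite -leNgt;
      [apply: (strc_nonneg2 h)|apply: (strc_nonneg1 h)];
      by rewrite /special (negbTE ij).
  rewrite /assocl /assocr !fsbig1 // => u _.
    by rewrite (Z _ _ t s 0 u).2 mul0r.
  by rewrite (Z _ _ t s u 0).1 mul0r.
have rv : entry_val r i j != 0 by rewrite entry_val_off // intr_eq0.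
apply: (mulfI rv); rewrite assocl_rec assocr_rec.
apply: eq_bigr => h _; apply: eq_bigr => g _; rewrite IH //.
rewrite ltnS in rN; apply: leq_trans rN.
rewrite [X in (_ < X)%N](bigD1 i) // [X in (_ < (X + _))%N](bigD1 j) //=.
rewrite (bigD1 i) // (bigD1 j) //= !mxE !eqxx /= -!addnA -addSn.
apply: leq_add; first lia.
apply: leq_add; apply: leq_sum => a.
  by rewrite !mxE => /andP[_ /negbTE ->]; rewrite andbF subr0.
by move=> /negbTE ai; apply: leq_sum => b _; rewrite !mxE ai subr0.
Qed.

End Associativity.

(** * The laws of the category C_(x, y) *)

Section FreeModules.
Context {K : nzRingType} {T : choiceType}.

Lemma fgliftD (M : lmodType K) (f : T -> M) (D E : {freeg T / K}) :
  fglift f (D + E) = fglift f D + fglift f E.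
Proof.
pose phi : {freeg T / K} -> M := fglift f.
have phiB : {morph phi : a b / a - b} by apply: lift_is_additive.
have phi0 : phi 0 = 0 by rewrite -(subrr 0) phiB subrr.
have phiN a : phi (- a) = - phi a by rewrite -sub0r phiB phi0 sub0r.
by have := phiB D (- E); rewrite phiN !opprK.
Qed.

Lemma fglift0 (M : lmodType K) (f : T -> M) : fglift f (0 : {freeg T / K}) = 0.
Proof. by apply: (addrI (fglift f 0)); rewrite -fgliftD !addr0. Qed.

Lemma fglift_sumE (M : lmodType K) (f : T -> M) (D : {freeg T / K}) :
  fglift f D = \sum_(z <- dom D) coeff z D *: f z.
Proof.
rewrite -[in LHS](freeg_sumE D) (big_morph _ (fgliftD f) (fglift0 f)).
by apply: eq_bigr => z _; rewrite liftU.
Qed.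

Lemma fgliftZ (M : lmodType K) (f : T -> M) c (D : {freeg T / K}) :
  fglift f (c *: D) = c *: fglift f D.
Proof.
have -> : c *: D = \sum_(z <- dom D) << c * coeff z D *g z >> by [].
rewrite (big_morph _ (fgliftD f) (fglift0 f)) fglift_sumE scaler_sumr.
by apply: eq_bigr => z _; rewrite liftU scalerA.
Qed.

Lemma eq_coeff (D E : {freeg T / K}) : (forall z, coeff z D = coeff z E) -> D = E.
Proof. by move=> DE; apply/eqP/freeg_eqP. Qed.

Lemma freegU_scale c (z : T) : << c *g z >> = c *: << z >> :> {freeg T / K}.
Proof. by apply: eq_coeff => u; rewrite coeffZ !coeffU mul1r. Qed.

Lemma freeg_linear_ext (M : lmodType K) (phi psi : {freeg T / K} -> M) :
  (forall D E, phi (D + E) = phi D + phi E) ->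
  (forall c D, phi (c *: D) = c *: phi D) ->
  (forall D E, psi (D + E) = psi D + psi E) ->
  (forall c D, psi (c *: D) = c *: psi D) ->
  (forall z, phi << z >> = psi << z >>) -> forall D, phi D = psi D.
Proof.
move=> phiD phiZ psiD psiZ E D; rewrite -(freeg_sumE D).
have z0 (f : {freeg T / K} -> M) : (forall D E, f (D + E) = f D + f E) -> f 0 = 0.
  by move=> fD; apply: (addrI (f 0)); rewrite -fD !addr0.
rewrite (big_morph phi phiD (z0 _ phiD)) (big_morph psi psiD (z0 _ psiD)).
by apply: eq_bigr => z _; rewrite freegU_scale phiZ psiZ E.
Qed.

Lemma dom_fsum (D : {freeg T / K}) (g : T -> K) :
  \sum_(z <- dom D) coeff z D * g z = \sum_(z \in setT) coeff z D * g z.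
Proof.
rewrite (fsbigTE (seq_fset tt (dom D))).
  by rewrite [RHS](perm_big _ (seq_fset_perm tt (dom D))) /= undup_id ?uniq_dom.
by move=> z; rewrite seq_fsetE mem_dom negbK => /eqP ->; rewrite mul0r.
Qed.

Lemma coeff_fglift (U : choiceType) (f : T -> {freeg U / K}) (D : {freeg T / K}) u :
  coeff u (fglift f D) = \sum_(z \in setT) coeff z D * coeff u (f z).
Proof.
rewrite fglift_sumE raddf_sum -dom_fsum; apply: eq_bigr => z _ /=.
by rewrite coeffZ.
Qed.

End FreeModules.

Lemma coeff_fgmap (K L : nzRingType) (phi : {rmorphism K -> L}) (T : choiceType)
    (D : {freeg T / K}) z :
  coeff z (fgmap phi D) = phi (coeff z D).
Proof.
rewrite /fgmap raddf_sum /= -[in RHS](freeg_sumE D) raddf_sum /= rmorph_sum.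
apply: eq_bigr => u _; rewrite !coeffU rmorphM /=.
by case: (u == z); rewrite ?rmorph1 ?rmorph0.
Qed.

(** The fields of [linCat] carry no axioms; these are the ones that hold for
    [C_linear] and its additive closure and that the argument needs. *)
Record category_laws (K : nzRingType) (C : linCat K) : Prop := CategoryLaws {
  hom_full : forall (X Y : obj C) (f : mor X Y), hom X Y f;
  compDl : forall (X Y Z : obj C) (g1 g2 : mor Y Z) (f : mor X Y),
    comp (g1 + g2) f = comp g1 f + comp g2 f;
  compDr : forall (X Y Z : obj C) (g : mor Y Z) (f1 f2 : mor X Y),
    comp g (f1 + f2) = comp g f1 + comp g f2;
  compA : forall (X Y Z W : obj C) (h : mor Z W) (g : mor Y Z) (f : mor X Y),
    comp h (comp g f) = comp (comp h g) f;
  comp1l : forall (X Y : obj C) (f : mor X Y), comp (idm Y) f = f;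
  comp1r : forall (X Y : obj C) (f : mor X Y), comp f (idm X) = f
}.

Section Category.
Context {F : numFieldType} (x y : F).
Local Notation strc := (strc x y).
Local Notation weight := (weight x y).
Local Notation CL := (C_linear x y).

Lemma specialize_tensor_coef l n m (A : tensor l n m) :
  specialize x y (tensor_coef A) = weight A.
Proof.
rewrite /tensor_coef rmorph_prod; apply: eq_bigr => i _.
rewrite rmorph_prod; apply: eq_bigr => k _ /=.
rewrite /specialize /= /multinomial /multinom /special.
case: ifP => [/andP[ik i2]|_]; last first.
  by rewrite mmapC /= fmorph_div /= !ratr_nat.
rewrite mmapZ /= fmorphV /= ratr_nat; congr (_ * _).
rewrite rmorph_prod; apply: eq_bigr => t _ /=.
rewrite mmapB mmapD mmapX mmap1U rmorph_nat rmorph_int; congr (_ + _ - _).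
by rewrite /offset /special ik i2 -val_eqE /= inordK.
Qed.

Lemma finite_Tmx a b (S : set 'M[int]_(len b, len a)) :
  finite_set S -> finite_set [set q : Tmx a b | S q].
Proof. by apply: finite_preimage => q q' _ _ /val_inj. Qed.

Section Coefficients.
Variables a b c : Tseq.

Lemma coeff_xi_mul (r : Tmx b c) (s : Tmx a b) (q : Tmx a c) :
  coeff q (xi_mul r s) = \sum_(A \in tensors r s q) tensor_coef A.
Proof.
pose f (q : Tmx a c) := \sum_(A \in tensors r s q) tensor_coef A.
have f0 (q' : Tmx a c) : (forall A, ~ tensors r s q' A) -> f q' = 0.
  by move=> h; rewrite /f fsbig1 // => A /h.
pose S := [set q : Tmx a c | exists A, tensors r s q A].
have Sfin : finite_set S.
  apply: (@finite_Tmx a c [set q | exists A, tensors r s q A]).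
  pose g (A : tensor (len c) (len b) (len a)) : 'M[int]_(len c, len a) :=
    \matrix_(i, k) \sum_j A (i, j, k).
  apply: sub_finite_set (finite_image g (finite_tensors_rs r s)) => q' [A Aq].
  exists A; first by exists q'.
  by case: Aq => _ _ Aq _; apply/matrixP => i k; rewrite mxE Aq.
rewrite /xi_mul (fsbigTE (fset_set S)); last first.
  move=> q'; rewrite in_fset_set // => /negP Sq.
  rewrite -/(f q') f0 ?freegU0 // => A TA; apply: Sq; apply/mem_set; by exists A.
rewrite raddf_sum /=.
under eq_bigr do rewrite coeffU -/(f _).
have [Sq|nSq] := boolP (q \in fset_set S).
  rewrite (bigD1_seq q) ?fset_uniq //= eqxx mulr1 big1 ?addr0 //.
  by move=> q' /negbTE ->; rewrite mulr0.
rewrite big_seq big1 => [|q' Sq'].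
  symmetry; apply: f0 => A TA; move: nSq; rewrite in_fset_set // => /negP; apply.
  by apply/mem_set; exists A.
by case: eqP Sq' nSq => [-> ->|]; rewrite ?mulr0.
Qed.

Lemma coeff_comp_basis (r : Tmx b c) (s : Tmx a b) (q : Tmx a c) :
  coeff q (fgmap (specialize x y) (xi_mul r s)) = strc r s q.
Proof.
rewrite coeff_fgmap coeff_xi_mul /strc !fsbig_finite; try exact: finite_tensors.
by rewrite rmorph_sum; apply: eq_bigr => A _; rewrite /= specialize_tensor_coef.
Qed.

End Coefficients.

Definition xi_comp a b c (r : Tmx b c) (s : Tmx a b) : {freeg (Tmx a c) / F} :=
  fgmap (specialize x y) (xi_mul r s).

Lemma compE (a b c : obj CL) (g : mor b c) (f : mor a b) :
  comp g f = fglift (fun r => fglift (fun s => xi_comp r s) f) g.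
Proof. by []. Qed.

Lemma C_linear_compDl (a b c : obj CL) (g1 g2 : mor b c) (f : mor a b) :
  comp (g1 + g2) f = comp g1 f + comp g2 f.
Proof. exact: fgliftD. Qed.

Lemma C_linear_compZl (a b c : obj CL) k (g : mor b c) (f : mor a b) :
  comp (k *: g) f = k *: comp g f.
Proof. exact: fgliftZ. Qed.

Lemma C_linear_compDr (a b c : obj CL) (g : mor b c) (f1 f2 : mor a b) :
  comp g (f1 + f2) = comp g f1 + comp g f2.
Proof.
rewrite !compE !fglift_sumE -big_split; apply: eq_bigr => r _ /=.
by rewrite fgliftD scalerDr.
Qed.

Lemma C_linear_compZr (a b c : obj CL) k (g : mor b c) (f : mor a b) :
  comp g (k *: f) = k *: comp g f.
Proof.
rewrite !compE !fglift_sumE scaler_sumr; apply: eq_bigr => r _ /=.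
by rewrite fgliftZ !scalerA mulrC.
Qed.

Lemma coeff_comp (a b c : obj CL) (g : mor b c) (f : mor a b) (q : Tmx a c) :
  coeff q (comp g f)
  = \sum_(r <- dom g) \sum_(s <- dom f) coeff r g * coeff s f * strc r s q.
Proof.
rewrite compE fglift_sumE raddf_sum; apply: eq_bigr => r _ /=.
rewrite fglift_sumE scaler_sumr raddf_sum; apply: eq_bigr => s _ /=.
by rewrite !coeffZ coeff_comp_basis mulrA.
Qed.

Lemma Tmx_nonneg a b (q : Tmx a b) : Tnonneg q.
Proof.
move=> i k h; have /and3P[/forallP/(_ i)/forallP/(_ k)/implyP h0 _ _] := valP q.
exact: h0.
Qed.

Lemma Tmx_row a b (q : Tmx a b) i : \sum_k q i k = entry b i.
Proof. by have /and3P[_ /forallP/(_ i)/eqP] := valP q. Qed.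

Lemma Tmx_col a b (q : Tmx a b) k : \sum_i q i k = entry a k.
Proof. by have /and3P[_ _ /forallP/(_ k)/eqP] := valP q. Qed.

(** The recursions leave [Tmx a b], so sums over that type are extended by zero
    to all integer matrices. *)
Lemma Tmx_sum a b (f : 'M[int]_(len b, len a) -> F) :
  (forall q, f q != 0 -> is_Tmx q) ->
  \sum_(q \in [set: Tmx a b]) f q = \sum_(q \in setT) f q.
Proof.
move=> fT; rewrite -[RHS](fsbig_widen [set q | is_Tmx q]) //; last first.
  move=> q [_ /= nq]; apply/eqP; apply: contraT => /fT Tq; case: (nq Tq).
rewrite (@reindex_fsbig _ _ _ _ _ (@Tmx_mx a b) setT) //.
split=> [q _|q q' _ _ /val_inj//|q Tq]; first exact: (valP q).
by exists (TMx Tq).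
Qed.

Lemma strc_is_Tmx a b c (r : Tmx b c) (s : Tmx a b) q :
  strc r s q != 0 -> @is_Tmx a c q.
Proof.
move=> c0; apply/and3P; split.
- apply/forallP => i; apply/forallP => k; apply/implyP; exact: (strc_nonneg3 c0).
- by apply/forallP => i; rewrite -(strc_rows13 c0) Tmx_row.
- by apply/forallP => k; rewrite -(strc_rows23 c0) Tmx_col.
Qed.

Lemma C_linear_compA (a b c d : obj CL) (h : mor c d) (g : mor b c) (f : mor a b) :
  comp h (comp g f) = comp (comp h g) f.
Proof.
move: h; apply: freeg_linear_ext => [D E|k D|D E|k D|t];
  rewrite ?C_linear_compDl ?C_linear_compZl //.
move: g; apply: freeg_linear_ext => [D E|k D|D E|k D|r];
  rewrite ?(C_linear_compDl, C_linear_compZl, C_linear_compDr, C_linear_compZr) //.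
move: f; apply: freeg_linear_ext => [D E|k D|D E|k D|s];
  rewrite ?(C_linear_compDl, C_linear_compZl, C_linear_compDr, C_linear_compZr) //.
apply: eq_coeff => p; rewrite !compE !liftU !scale1r !coeff_fglift.
transitivity (\sum_(v \in [set: Tmx a c]) strc r s v * strc t v p).
  by apply: eq_fsbigr => v _; rewrite !coeff_comp_basis.
rewrite (Tmx_sum (f := fun v => strc r s v * strc t v p)); last first.
  by move=> q; rewrite mulf_eq0 negb_or => /andP[/strc_is_Tmx].
transitivity (\sum_(v \in [set: Tmx b d]) strc t r v * strc v s p); last first.
  by apply: eq_fsbigr => v _; rewrite liftU scale1r !coeff_comp_basis.
rewrite (Tmx_sum (f := fun v => strc t r v * strc v s p)); last first.
  by move=> q; rewrite mulf_eq0 negb_or => /andP[/strc_is_Tmx].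
symmetry; exact: strc_assoc.
Qed.

Lemma diag_mx_of_diag a : is_diag (diag_mx_of a).
Proof. by move=> i j ij; rewrite mxE -val_eqE (negbTE ij). Qed.

Lemma C_linear_comp1l (a b : obj CL) (f : mor a b) : comp (idm b) f = f.
Proof.
move: f; apply: freeg_linear_ext => [D E|k D|//|//|s];
  rewrite ?(C_linear_compDr, C_linear_compZr) //.
apply: eq_coeff => q; rewrite compE !liftU !scale1r coeff_comp_basis coeffU mul1r.
case: eqP => [->|sq].
  apply: strc_diagl => //; first exact: diag_mx_of_diag.
    exact: Tmx_nonneg.
  by move=> i j /val_inj <-; rewrite mxE eqxx Tmx_row.
apply/eqP; apply: contraT => /(strc_diagl_neq0 (@diag_mx_of_diag b))[_ E].
by case: sq; apply/val_inj/matrixP => i k; rewrite -!rowxE E.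
Qed.

Lemma C_linear_comp1r (a b : obj CL) (f : mor a b) : comp f (idm a) = f.
Proof.
move: f; apply: freeg_linear_ext => [D E|k D|//|//|s];
  rewrite ?(C_linear_compDl, C_linear_compZl) //.
have dT : is_diag (diag_mx_of a)^T.
  by move=> i j ij; rewrite !mxE -val_eqE eq_sym (negbTE ij).
apply: eq_coeff => q; rewrite compE !liftU !scale1r coeff_comp_basis coeffU mul1r.
rewrite -strc_tr; case: eqP => [->|sq].
  apply: strc_diagl => //.
    move=> i k h; rewrite mxE; apply: Tmx_nonneg; apply: contra h.
    by rewrite /special => /andP[/eqP ->]; rewrite eqxx.
  move=> i j /val_inj <-; rewrite !mxE eqxx -(Tmx_col q).
  by apply: eq_bigr => k _; rewrite mxE.
apply/eqP; apply: contraT => /(strc_diagl_neq0 dT)[_ E].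
by case: sq; apply/val_inj/matrixP => i k; have := E k i; rewrite !rowxE !mxE.
Qed.

Theorem C_linear_laws : category_laws CL.
Proof.
split=> //.
- exact: C_linear_compDl.
- exact: C_linear_compDr.
- exact: C_linear_compA.
- exact: C_linear_comp1l.
- exact: C_linear_comp1r.
Qed.

End Category.

(** * Orthogonal idempotents and direct sums *)

Section LawfulCategories.
Context {K : nzRingType} {C : linCat K} (CL : category_laws C).
Implicit Types X Y Z : obj C.

Lemma comp0l X Y Z (f : mor X Y) : comp (0 : mor Y Z) f = 0.
Proof. by apply: (addrI (comp 0 f)); rewrite -(compDl CL) !addr0. Qed.

Lemma comp0r X Y Z (g : mor Y Z) : comp g (0 : mor X Y) = 0.
Proof. by apply: (addrI (comp g 0)); rewrite -(compDr CL) !addr0. Qed.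

Lemma compBl X Y Z (g1 g2 : mor Y Z) (f : mor X Y) :
  comp (g1 - g2) f = comp g1 f - comp g2 f.
Proof. by apply/eqP; rewrite eq_sym subr_eq -(compDl CL) subrK. Qed.

Lemma compBr X Y Z (g : mor Y Z) (f1 f2 : mor X Y) :
  comp g (f1 - f2) = comp g f1 - comp g f2.
Proof. by apply/eqP; rewrite eq_sym subr_eq -(compDr CL) subrK. Qed.

Lemma comp_suml X Y Z (I : finType) (g : I -> mor Y Z) (f : mor X Y) :
  comp (\sum_i g i) f = \sum_i comp (g i) f.
Proof.
exact: (big_morph (fun g => comp g f) (fun a b => compDl CL a b f) (comp0l Z f)).
Qed.

Lemma comp_sumr X Y Z (I : finType) (g : mor Y Z) (f : I -> mor X Y) :
  comp g (\sum_i f i) = \sum_i comp g (f i).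
Proof. exact: (big_morph (comp g) (compDr CL g) (comp0r X g)). Qed.

Lemma ac_id_diag (X : ac_obj C) i : @ac_id K C X i i = idm (tagged X i).
Proof.
rewrite /ac_id; case: eqP => // e; by rewrite (eq_irrelevance e (erefl _)).
Qed.

Lemma ac_id_off (X : ac_obj C) j i : i != j -> @ac_id K C X j i = 0.
Proof. by rewrite /ac_id; case: eqP. Qed.

Lemma additive_closure_laws : category_laws (additive_closure C).
Proof.
split.
- by move=> X Y f j i; apply: hom_full CL _ _ _.
- move=> X Y Z g1 g2 f; apply: ac_morP => k i.
  rewrite -[RHS]/(ac_comp g1 f k i + ac_comp g2 f k i) -big_split.
  by apply: eq_bigr => j _; apply: compDl CL _ _ _ _ _ _.
- move=> X Y Z g f1 f2; apply: ac_morP => k i.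
  rewrite -[RHS]/(ac_comp g f1 k i + ac_comp g f2 k i) -big_split.
  by apply: eq_bigr => j _; apply: compDr CL _ _ _ _ _ _.
- move=> X Y Z W h g f; apply: ac_morP => l i /=; rewrite /ac_comp.
  under eq_bigr do rewrite comp_sumr; under [RHS]eq_bigr do rewrite comp_suml.
  rewrite exchange_big; apply: eq_bigr => j _; apply: eq_bigr => k _.
  exact: compA CL _ _ _ _ _ _ _.
- move=> X Y f; apply: ac_morP => k i /=; rewrite /ac_comp (bigD1 k) //=.
  rewrite ac_id_diag (comp1l CL) big1 ?addr0 // => j jk.
  by rewrite ac_id_off ?comp0l.
- move=> X Y f; apply: ac_morP => k i /=; rewrite /ac_comp (bigD1 i) //=.
  rewrite ac_id_diag (comp1r CL) big1 ?addr0 // => j ji.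
  by rewrite ac_id_off ?comp0r // eq_sym.
Qed.

Section Endomorphisms.
Variable X : obj C.
Implicit Types u v : mor X X.

Definition orth_family n (s : 'I_n -> mor X X) u : Prop :=
  [/\ (forall k, comp (s k) (s k) = s k),
      (forall k l, k != l -> comp (s k) (s l) = 0)
    & \sum_k s k = u].

Definition primitive u : Prop :=
  [/\ comp u u = u, u <> 0
    & forall s : 'I_2 -> mor X X, orth_family s u -> exists k, s k = 0].

Lemma orth_absorb n (s : 'I_n -> mor X X) u k : orth_family s u ->
  comp u (s k) = s k /\ comp (s k) u = s k.
Proof.
case=> sid sorth <-; split.
  rewrite comp_suml (bigD1 k) //= sid big1 ?addr0 // => l lk; exact: sorth.
rewrite comp_sumr (bigD1 k) //= sid big1 ?addr0 // => l lk.
by apply: sorth; rewrite eq_sym.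
Qed.

Definition cat_family m n (s : 'I_m -> mor X X) (t : 'I_n -> mor X X) :
  'I_(m + n) -> mor X X :=
  fun k => match fintype.split k with inl i => s i | inr j => t j end.

Lemma cat_family_orth m n (s : 'I_m -> mor X X) (t : 'I_n -> mor X X) u v :
  orth_family s u -> orth_family t v -> comp u v = 0 -> comp v u = 0 ->
  orth_family (cat_family s t) (u + v).
Proof.
move=> Hs Ht uv vu; have [s1 s2 s3] := Hs; have [t1 t2 t3] := Ht.
split=> [k|k l|].
- by rewrite /cat_family; case: fintype.split.
- rewrite -[k]fintype.splitK -[l]fintype.splitK /cat_family !fintype.unsplitK.
  case: (fintype.split k) => i; case: (fintype.split l) => j /=.
  + by move=> ij; apply: s2; apply: contraNneq ij => ->.
  + move=> _; have [_ <-] := orth_absorb i Hs; have [<- _] := orth_absorb j Ht.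
    by rewrite -(compA CL) (compA CL u) uv comp0l comp0r.
  + move=> _; have [_ <-] := orth_absorb i Ht; have [<- _] := orth_absorb j Hs.
    by rewrite -(compA CL) (compA CL v) vu comp0l comp0r.
  + by move=> ij; apply: t2; apply: contraNneq ij => ->.
- rewrite big_split_ord -s3 -t3; congr (_ + _); apply: eq_bigr => i _.
    by rewrite /cat_family (fintype.unsplitK (inl i)).
  by rewrite /cat_family (fintype.unsplitK (inr i)).
Qed.

Definition orth_bound n u : Prop :=
  forall m (s : 'I_m -> mor X X), orth_family s u -> (forall k, s k <> 0) ->
  (m <= n)%N.

Lemma orth_single u : comp u u = u -> orth_family (fun _ : 'I_1 => u) u.
Proof. by move=> uu; split=> // [k l|]; rewrite ?ord1 ?big_ord1 // !ord1 eqxx. Qed.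

(** Split an idempotent that is not primitive in two nonzero parts; adjoining one
    part to an orthogonal family below the other shows that the bound drops. *)
Lemma primitive_decomposition n u : comp u u = u -> orth_bound n u ->
  exists m (s : 'I_m -> mor X X), orth_family s u /\ forall k, primitive (s k).
Proof.
elim: n u => [|n IH] u uu bu.
  have u0 : u = 0.
    apply: contrapT => u0; have := bu _ _ (orth_single uu) (fun=> u0).
    by rewrite ltn0.
  exists 0%N, (fun=> 0); split=> [|[]//]; split=> [[]//|[]//|].
  by rewrite big_ord0.
case: (pselect (u = 0)) => [u0|u0].
  by exists 0%N, (fun=> 0); split=> [|[]//]; split=> [[]//|[]//|]; rewrite big_ord0.
case: (pselect (primitive u)) => [pu|npu].
  by exists 1%N, (fun=> u); split=> //; apply: orth_single.
have [s Hs s0] : exists2 s : 'I_2 -> mor X X, orth_family s u & forall k, s k <> 0.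
  apply: contrapT => h; apply: npu; split=> // s Hs; apply: contrapT => h'.
  by apply: h; exists s => // k sk; apply: h'; exists k.
have [s1 s2 s3] := Hs.
have sb k l : k != l -> s k + s l = u -> orth_bound n (s k).
  move=> kl E m t Ht t0; rewrite -ltnS -addn1.
  apply: (bu _ (cat_family t (fun _ : 'I_1 => s l))).
    rewrite -E; apply: cat_family_orth => //; first exact: orth_single.
      by apply: s2.
    by apply: s2; rewrite eq_sym.
  by move=> i; rewrite /cat_family; case: fintype.split.
have E : s ord0 + s ord_max = u.
  by rewrite -s3 big_ord_recl big_ord1; congr (_ + s _); apply: val_inj.
have [m1 [t1 [Ht1 pt1]]] := IH _ (s1 ord0) (sb ord0 ord_max isT E).
have E' : s ord_max + s ord0 = u by rewrite addrC.
have [m2 [t2 [Ht2 pt2]]] := IH _ (s1 ord_max) (sb ord_max ord0 isT E').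
exists (m1 + m2)%N, (cat_family t1 t2); split.
  by rewrite -E; apply: cat_family_orth => //; apply: s2.
by move=> k; rewrite /cat_family; case: fintype.split.
Qed.

End Endomorphisms.

Local Notation KC := (idempotent_completion C).

Definition split_obj A (u : mor A A) (uu : comp u u = u) : obj KC :=
  @Idempotent K C A u (hom_full CL u) uu.

Lemma direct_sum_split (X : obj KC) n (s : 'I_n -> mor (idem_obj X) (idem_obj X))
    (Hs : orth_family s (idem_map X)) :
  direct_sum X (fun k => let: And3 sid _ _ := Hs in split_obj (sid k)).
Proof.
have Ha k := orth_absorb k Hs.
case: Hs Ha => sid sorth sE Ha.
exists (fun k => s k), (fun k => s k); split=> //=; last first.
  by rewrite -sE; apply: eq_bigr => k _; apply: sid.
by move=> k; have [Hl Hr] := Ha k; split; split=> //; exact: (hom_full CL).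
Qed.

(** The objects of a direct sum decomposition of X are arbitrary, but they induce
    the orthogonal idempotents inj k o prj k on the object underlying X, and
    these determine which of the objects are zero. *)
Lemma primitive_indecomposable (X : obj KC) :
  primitive (idem_map X) -> indecomposable X.
Proof.
case=> _ X0 Xp; split=> // Y [inj [prj [H1 H2 H3 H4]]].
pose s k : mor (idem_obj X) (idem_obj X) := comp (inj k) (prj k : mor _ (idem_obj (Y k))).
have Hs : orth_family s (idem_map X).
  split=> [k|k l kl|]; last exact: H4.
    rewrite /s -(compA CL) (compA CL (prj k)).
    have -> : comp (prj k : mor _ (idem_obj (Y k))) (inj k) = idem_map (Y k) by exact: H2.
    by have [_ [_ -> _]] := H1 k.
  rewrite /s -(compA CL) (compA CL (prj k)).
  have -> : comp (prj k : mor _ (idem_obj (Y k))) (inj l : mor (idem_obj (Y l)) _) = 0.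
    exact: H3.
  by rewrite comp0l comp0r.
have [k sk] := Xp s Hs; exists k.
pose i : mor (idem_obj (Y k)) (idem_obj X) := inj k.
pose p : mor (idem_obj X) (idem_obj (Y k)) := prj k.
have E : comp p i = idem_map (Y k) by exact: H2.
have S : comp i p = 0 by exact: sk.
by rewrite /is_zero_obj [LHS]/= -(idemK (Y k)) -E -(compA CL) (compA CL i) S
  comp0l comp0r.
Qed.

End LawfulCategories.

(** * A criterion for the failure of uniqueness *)

Section SingleObjects.
Context {K : nzRingType} {C : linCat K} (CL : category_laws C) (M : obj C).
Let acM := ac_single M.
Let DL := additive_closure_laws CL.

Definition single_mor (a : mor M M) : mor acM acM := fun _ _ => a.

Lemma single_morE (f : mor acM acM) : f = single_mor (f ord0 ord0).
Proof. by apply: ac_morP => j i; rewrite (ord1 i) (ord1 j). Qed.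

Lemma single_comp (f g : mor acM acM) j i :
  comp g f j i = comp (g ord0 ord0) (f ord0 ord0).
Proof. by rewrite /= /ac_comp big_ord1 (ord1 i) (ord1 j). Qed.

Lemma single_idm : idm acM = single_mor (idm M).
Proof. by apply: ac_morP => j i; rewrite (ord1 i) (ord1 j) /= ac_id_diag. Qed.

Lemma single_sum n (s : 'I_n -> mor acM acM) j i :
  (\sum_k s k) j i = \sum_k s k j i.
Proof.
by apply: (big_rec2 (fun (f : mor acM acM) x => f j i = x)) => // k x f _ <-.
Qed.

Lemma single_orth n (s : 'I_n -> mor M M) u :
  orth_family s u -> orth_family (fun k => single_mor (s k)) (single_mor u).
Proof.
case=> s1 s2 s3; split=> [k|k l kl|]; apply: ac_morP => j i.
- by rewrite single_comp s1.
- by rewrite single_comp s2.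
- by rewrite single_sum s3.
Qed.

Lemma single_primitive u : primitive u -> primitive (single_mor u).
Proof.
case=> u1 u0 up; split.
- by apply: ac_morP => j i; rewrite single_comp u1.
- by move=> /(congr1 (fun f : mor acM acM => f ord0 ord0)).
move=> s [s1 s2 s3].
have [|k sk] := up (fun k => s k ord0 ord0).
  split=> [k|k l kl|].
  - by rewrite -[RHS](congr1 (fun f : mor acM acM => f ord0 ord0) (s1 k)) single_comp.
  - by rewrite -[RHS](congr1 (fun f : mor acM acM => f ord0 ord0) (s2 k l kl)) single_comp.
  - by rewrite -single_sum s3.
by exists k; rewrite (single_morE (s k)) sk.
Qed.

End SingleObjects.

Section NonUniqueness.
Context {F : fieldType} {C : linCat F} (CL : category_laws C) (M : obj C).
Context (homM : hom M M (idm M)) (idM : comp (idm M) (idm M) = idm M).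
Let KM := karoubian_obj homM idM.
Let DL := additive_closure_laws CL.

(** Decompose 1 - e and 1 - f.  If uniqueness held then e would be equivalent to
    f or to some g with f g = 0.  In the second case chi g = 0, but chi takes the
    same value on equivalent idempotents. *)
Lemma not_unique_decomposition (chi : mor M M -> F) (e f : mor M M) b :
  primitive e -> primitive f ->
  (forall u v, chi (comp u v) = chi u * chi v) -> chi 0 = 0 ->
  chi e != 0 -> chi f != 0 ->
  (forall u v : mor M M, comp u v = f -> comp v u = e -> False) ->
  (forall u : mor M M, orth_bound b u) ->
  ~ unique_decomposition KM.
Proof.
move=> pe pf chiM chi0 chie chif nef bnd uniqM.
have dec u : primitive u -> exists m (s : 'I_m -> mor M M),
    [/\ orth_family s (idm M), (forall k, primitive (s k)) &
        exists2 k, s k = u & forall l, l != k -> comp u (s l) = 0].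
  move=> pu; have [uu _ _] := pu.
  have ucu : comp u (idm M - u) = 0.
    by rewrite (compBr CL) (comp1r CL) uu subrr.
  have cuu : comp (idm M - u) u = 0.
    by rewrite (compBl CL) (comp1l CL) uu subrr.
  have cc : comp (idm M - u) (idm M - u) = idm M - u.
    by rewrite (compBr CL) (comp1r CL) cuu subr0.
  have [m [s [Hs ps]]] := primitive_decomposition CL cc (bnd _).
  pose t := cat_family (fun _ : 'I_1 => u) s.
  have Ht : orth_family t (idm M).
    have -> : idm M = u + (idm M - u) by rewrite addrC subrK.
    by apply: (cat_family_orth CL) => //; apply: orth_single.
  exists (1 + m)%N, t; split=> //.
    by move=> k; rewrite /t /cat_family; case: fintype.split.
  exists (lshift m ord0); first by rewrite /t /cat_family (fintype.unsplitK (inl ord0)).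
  move=> l kl; have [_ t2 _] := Ht.
  have -> : u = t (lshift m ord0) by rewrite /t /cat_family (fintype.unsplitK (inl ord0)).
  by apply: t2; rewrite eq_sym.
have [m [s [Hs ps [k sk _]]]] := dec e pe.
have [n [t [Ht pt [l tl fl]]]] := dec f pf.
have idKM : idem_map KM = single_mor (idm M) by exact: (single_idm M).
have dec' n' (r : 'I_n' -> mor M M) (Hr : orth_family r (idm M)) :
    orth_family (fun k => single_mor (r k)) (idem_map KM).
  by rewrite idKM; apply: single_orth.
have ind n' (r : 'I_n' -> mor M M) (Hr : orth_family r (idm M)) :
    (forall k, primitive (r k)) ->
    decomposition KM (fun k => let: And3 sid _ _ := dec' _ _ Hr in split_obj DL (sid k)).
  move=> pr; split; first exact: (direct_sum_split DL).
  move=> k'; apply: (primitive_indecomposable DL).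
  by case: (dec' _ _ _) => sid _ _; apply: single_primitive.
have [h [_ hiso]] := uniqM _ _ _ _ (ind _ _ Hs ps) (ind _ _ Ht pt).
have {hiso} [u [v [vu uv]]] : exists u v : mor M M,
    comp v u = e /\ comp u v = t (h k).
  have := hiso k; case: (dec' _ _ Hs) => sid1 _ _; case: (dec' _ _ Ht) => sid2 _ _.
  case=> u [v [_ _ vu uv]].
  pose u' : mor (ac_single M) (ac_single M) := u.
  pose v' : mor (ac_single M) (ac_single M) := v.
  exists (u' ord0 ord0), (v' ord0 ord0); split.
    rewrite -(single_comp u' v' ord0 ord0) -sk.
    by rewrite -[RHS]/(single_mor (s k) ord0 ord0); congr (_ ord0 ord0).
  rewrite -(single_comp v' u' ord0 ord0).
  by rewrite -[RHS]/(single_mor (t (h k)) ord0 ord0); congr (_ ord0 ord0).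
have [hkl|hkl] := eqVneq (h k) l.
  by apply: (nef u v); rewrite // uv hkl tl.
have := fl _ hkl; move/(congr1 chi); rewrite chiM chi0 => /eqP.
rewrite mulf_eq0 (negbTE chif) /= -uv chiM mulrC -chiM vu.
exact/negP.
Qed.

End NonUniqueness.

(** * Degrees and leading coefficients *)

Section Degree.
Context {F : numFieldType} (x y : F).
Local Notation strc := (strc x y).
Local Notation weight := (weight x y).

(** The degree of the basis element of q: the sum of the off-diagonal entries. *)
Definition offdeg n m (q : 'M[int]_(n, m)) : int :=
  \sum_(i < n) \sum_(k < m) (i != k :> nat)%:R * q i k.

(** The coefficient on the right is the defect of the triangle inequality for the
    discrete distance on indices, so it is nonnegative. *)
Lemma offdeg_tensor l n m (r : 'M[int]_(l, n)) (s : 'M[int]_(n, m)) q A :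
  tensors r s q A ->
  offdeg r + offdeg s - offdeg q
  = \sum_(u : 'I_l * 'I_n * 'I_m)
      ((u.1.1 != u.1.2 :> nat)%:R + (u.1.2 != u.2 :> nat)%:R
        - (u.1.1 != u.2 :> nat)%:R) * A u.
Proof.
case=> _ Ar Aq As; rewrite /offdeg.
under eq_bigr do under eq_bigr do rewrite -Ar mulr_sumr.
under [X in _ + X - _]eq_bigr do under eq_bigr do rewrite -As mulr_sumr.
under [X in _ - X]eq_bigr do under eq_bigr do rewrite -Aq mulr_sumr.
under [X in _ + X - _]eq_bigr do rewrite exchange_big.
rewrite [X in _ + X - _]exchange_big /=.
under [X in _ - X]eq_bigr do rewrite exchange_big.
rewrite !pair_bigA -big_split -sumrB; apply: eq_bigr => -[[i j] k] _ /=.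
by rewrite mulrBl mulrDl.
Qed.

Lemma triangle_ge0 (i j k : nat) :
  0 <= (i != j)%:R + (j != k)%:R - (i != k)%:R :> int.
Proof.
case: (i =P j) => [->|_] /=; first by rewrite add0r subrr.
by case: (j == k); case: (i == k).
Qed.

Lemma offdeg_term_ge0 l n m (r : 'M[int]_(l, n)) (s : 'M[int]_(n, m)) q A
    (u : 'I_l * 'I_n * 'I_m) :
  tensors r s q A ->
  0 <= ((u.1.1 != u.1.2 :> nat)%:R + (u.1.2 != u.2 :> nat)%:R
        - (u.1.1 != u.2 :> nat)%:R) * A u.
Proof.
case: u => [[i j] k] [A0 _ _ _] /=.
have [/and3P[/eqP -> /eqP -> _]|h] := boolP (special3 i j k).
  by rewrite !eqxx mul0r.
by rewrite mulr_ge0 ?triangle_ge0 ?A0.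
Qed.

Lemma strc_offdeg l n m (r : 'M[int]_(l, n)) (s : 'M[int]_(n, m)) q :
  strc r s q != 0 -> offdeg q <= offdeg r + offdeg s.
Proof.
case/strc_neq0=> A TA; rewrite -subr_ge0 (offdeg_tensor TA).
apply: sumr_ge0 => u _; exact: offdeg_term_ge0 TA.
Qed.

Section Leading.
Variables (n : nat) (r s : 'M[int]_n).

(** In top degree the off-diagonal entries of the factors add up; the diagonal is
    then forced by the row sums. *)
Definition topdiag (i : 'I_n) : int := r i i - \sum_(k | k != i) s i k.

Definition topmx : 'M[int]_n :=
  \matrix_(i, k) if i == k then topdiag i else r i k + s i k.

Definition toptensor : tensor n n n :=
  [ffun u : 'I_n * 'I_n * 'I_n =>
     if u.1.1 == u.1.2 then (if u.1.2 == u.2 then topdiag u.1.1 else s u.1.2 u.2)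
     else if u.1.2 == u.2 then r u.1.1 u.1.2 else 0].

(** Without loss of degree all entries with i <> j <> k vanish, and then the
    margins determine the tensor. *)
Lemma top_unique q A : tensors r s q A ->
  offdeg r + offdeg s <= offdeg q -> A = toptensor.
Proof.
move=> TA dq; have [A0 Ar _ As] := TA.
have Z (i j k : 'I_n) : i != j -> j != k -> A (i, j, k) = 0.
  move=> ij jk.
  have := sum0_nonneg (i, j, k) _ (fun u => offdeg_term_ge0 u TA).
  rewrite -(offdeg_tensor TA) => /=.
  have -> : offdeg r + offdeg s - offdeg q = 0.
    apply/eqP; rewrite eq_le subr_le0 dq /= (offdeg_tensor TA).
    apply: sumr_ge0 => u _; exact: offdeg_term_ge0 TA.
  move=> /(_ erefl)/eqP; rewrite mulf_eq0 => /orP[|/eqP//].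
  rewrite !val_eqE ij jk; by case: (i != k).
have S1 (j k : 'I_n) : j != k -> A (j, j, k) = s j k.
  move=> jk; rewrite -As (bigD1 j) //= big1 ?addr0 // => i ij; exact: Z.
have S2 (i j : 'I_n) : i != j -> A (i, j, j) = r i j.
  move=> ij; rewrite -Ar (bigD1 j) //= big1 ?addr0 // => k kj.
  by apply: Z => //; rewrite eq_sym.
apply/ffunP => -[[i j] k]; rewrite ffunE /=.
have [<-|ij] := eqVneq i j; have [ik|ik] := eqVneq _ k.
- rewrite -ik /topdiag -Ar (bigD1 i) //=.
  rewrite [X in _ + X - _](eq_bigr (fun k => s i k)) ?addrK // => k' ki.
  by apply: S1; rewrite eq_sym.
- exact: S1.
- by rewrite -ik S2.
- exact: Z.
Qed.

Lemma toptensor_sum2 i k : \sum_j toptensor (i, j, k) = topmx i k.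
Proof.
rewrite mxE; under eq_bigr do rewrite ffunE /=.
have [->|ik] := eqVneq i k.
  rewrite (bigD1 k) //= !eqxx big1 ?addr0 // => j jk.
  by rewrite eq_sym (negbTE jk).
have ki : k != i by rewrite eq_sym.
rewrite (bigD1 i) //= eqxx ?(negbTE ik) (bigD1 k) //= ?(negbTE ik) eqxx.
rewrite big1 ?addr0 1?addrC // => j /andP[ji jk].
by rewrite eq_sym (negbTE ji) (negbTE jk).
Qed.

Lemma strc_top_eq q : strc r s q != 0 ->
  offdeg r + offdeg s <= offdeg q -> q = topmx.
Proof.
case/strc_neq0=> A TA dq; apply/matrixP => i k; rewrite -toptensor_sum2.
by rewrite -(top_unique TA dq); case: TA => _ _ <-.
Qed.

Lemma toptensor_tensors : Tnonneg r -> Tnonneg s ->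
  (forall j, \sum_i r i j = \sum_k s j k) ->
  (forall i : 'I_n, (2 <= i)%N -> 0 <= topdiag i) ->
  tensors r s topmx toptensor.
Proof.
move=> r0 s0 rs d0; split=> [i j k h|i j|i k|j k].
- rewrite ffunE /=; have [ij|ij] := eqVneq i j; have [jk|jk] := eqVneq j k => //.
  + by apply: d0; move: h; rewrite /special3 ij jk !eqxx /= -leqNgt.
  + by apply: s0; rewrite /special -[(j == k :> nat)]/(val j == val k) val_eqE (negbTE jk).
  + by apply: r0; rewrite /special -[(i == j :> nat)]/(val i == val j) val_eqE (negbTE ij).
- under eq_bigr do rewrite ffunE /=.
  have [<-|ij] := eqVneq i j.
    rewrite (bigD1 i) //= eqxx /topdiag.
    rewrite (eq_bigr (fun k => s i k)) ?subrK // => k ki.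
    by rewrite eq_sym (negbTE ki).
  rewrite (bigD1 j) //= eqxx big1 ?addr0 // => k kj.
  by rewrite eq_sym (negbTE kj).
- exact: toptensor_sum2.
- under eq_bigr do rewrite ffunE /=.
  have [<-|jk] := eqVneq j k.
    rewrite (bigD1 j) //= eqxx /topdiag (eq_bigr (fun i => r i j)); last first.
      by move=> i /negbTE ->.
    have := rs j; rewrite (bigD1 j) //= [in X in _ = X -> _](bigD1 j) //= => E.
    by rewrite addrAC E addrK.
  rewrite (bigD1 j) //= eqxx big1 ?addr0 // => i ij.
  by rewrite (negbTE ij).
Qed.

Lemma offdeg_topmx : offdeg topmx = offdeg r + offdeg s.
Proof.
rewrite /offdeg -big_split; apply: eq_bigr => i _ /=.
rewrite -big_split; apply: eq_bigr => k _ /=; rewrite mxE -val_eqE /=.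
by case: eqP; rewrite ?mul0r ?addr0 // !mul1r.
Qed.

Lemma strc_top : Tnonneg r -> Tnonneg s ->
  (forall j, \sum_i r i j = \sum_k s j k) ->
  (forall i : 'I_n, (2 <= i)%N -> 0 <= topdiag i) ->
  strc r s topmx != 0.
Proof.
move=> r0 s0 rs d0; have TA := toptensor_tensors r0 s0 rs d0.
rewrite /strc (_ : tensors r s topmx = [set toptensor]) ?fsbig_set1; last first.
  apply/seteqP; split=> [A TB|A -> //]; apply: top_unique TB _.
  by rewrite offdeg_topmx.
apply/prodf_neq0 => i _; apply/prodf_neq0 => k _.
have [<-|ik] := eqVneq i k.
  rewrite multinom_single ?oner_neq0 // => j ji; rewrite ffunE /=.
  by move: ji; rewrite val_eqE => /negbTE ji; rewrite eq_sym ji.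
rewrite /multinom /special val_eqE (negbTE ik) /=.
by rewrite mulf_neq0 ?invr_eq0 ?prod_fact_neq0 // pnatr_eq0 -lt0n fact_gt0.
Qed.

End Leading.

End Degree.

(** * The functor of coinvariants *)

Section TrivialCharacter.
Context {F : numFieldType} (x y : F).
Local Notation strc := (strc x y).
Local Notation entry_val := (entry_val x y).
Local Notation offset := (offset x y).

(** For natural numbers kappa_i, the words of content alpha form a basis of
    M^alpha, and xi_q maps a word to the sum of the words in relative position q
    to it.  This is the number of terms of that sum, in other words the action of
    xi_q on coinvariants: the product of the multinomials of the columns of q. *)
Definition col_multinom n m (q : 'M[int]_(n, m)) : F :=
  \prod_(k < m) multinom (special k k) k (offset k k) (fun i => q i k).

Lemma col_multinom_decr n m (q : 'M_(n, m)) (i : 'I_n) (k : 'I_m) :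
  Tnonneg (q - delta_mx i k) ->
  entry_val q i k * col_multinom q
  = (offset k k + (\sum_i q i k)%:~R) * col_multinom (q - delta_mx i k).
Proof.
move=> q0; rewrite /col_multinom (bigD1 k) //= [in RHS](bigD1 k) //= !mulrA.
congr (_ * _); last first.
  apply: eq_bigr => k' kk'; congr (multinom _ _ _ _); apply/funext => j.
  by rewrite !mxE (negbTE kk') andbF subr0.
have E (j : 'I_n) : special k k && (j == k :> nat) = special j k.
  by rewrite /special eqxx /=; case: eqP => [->|]; rewrite ?andbF ?andbT.
have -> : entry_val q i k = (if special k k && (i == k :> nat) then offset k k else 0)
    + (q i k)%:~R.
  rewrite /entry_val E /offset; case: ifP => // /andP[/eqP -> k2].
  by rewrite /special eqxx k2.
rewrite multinom_decr; last 3 first.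
- by move=> /negbTE h; rewrite /offset h.
- move=> j; rewrite E => /q0; rewrite !mxE eqxx andbT; case: (j == i) => /=; lia.
- by rewrite E => /q0; rewrite !mxE !eqxx /=; lia.
congr (_ * multinom _ _ _ _); apply/funext => j.
by rewrite !mxE eqxx andbT.
Qed.

Lemma sum_entry_val n m (s : 'M_(n, m.+2)) j :
  \sum_k entry_val s j k = offset j j + (\sum_k s j k)%:~R.
Proof.
rewrite big_split /= rmorph_sum; congr (_ + _).
rewrite /offset /special eqxx /=.
case: ltnP => j2; last by rewrite big1 // => k _; rewrite andbF.
have jm : (j < m.+2)%N by apply: leq_trans j2 _.
rewrite (bigD1 (Ordinal jm)) //= eqxx big1 ?addr0 // => k kj.
by rewrite ifF //; apply: contraNF kj => /andP[/eqP jk _]; apply/eqP/val_inj.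
Qed.

Lemma col_multinom_rowx n n' m (s : 'M_(n, m)) (q : 'M_(n', m)) :
  (forall i k, rowx s i k = rowx q i k) -> col_multinom q = col_multinom s.
Proof.
move=> sq; apply: eq_bigr => k _.
rewrite -(multinom_extend _ _ _ _ (leq_maxl n n')) -(multinom_extend _ _ _ _ (leq_maxr n n')).
by congr (multinom _ _ _ _); apply/funext => j; rewrite -/(rowx s j k) -/(rowx q j k) sq.
Qed.

(** The same induction as for [strc_assoc]: reduce an off-diagonal entry of r by
    [strc_recl] and absorb the factor q_ik into the column k of q. *)
Lemma col_multinom_mul l n m (r : 'M_(l, n)) (s : 'M_(n, m.+2)) :
  Tnonneg r -> Tnonneg s -> (forall j, \sum_i r i j = \sum_k s j k) ->
  (2 <= l)%N ->
  \sum_(q \in setT) strc r s q * col_multinom q = col_multinom r * col_multinom s.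
Proof.
have sum1 n' (j' : 'I_n') : \sum_i (i == j')%:R = 1 :> int.
  by rewrite (bigD1 j') //= eqxx big1 ?addr0 // => i' /negbTE ->.
have [N] := ubnP (\sum_(i < l) \sum_(j < n | i != j :> nat) absz (r i j))%N.
elim: N => // N IH in r s * => rN r0 s0 rs l2.
case: (pselect (is_diag r)) => [rd|nd].
  pose q : 'M[int]_(l, m.+2) := \matrix_(i, k) rowx s i k.
  have sq i k : rowx s i k = rowx q i k.
    case: (ltnP i l) => il; first by rewrite (rowxE q (Ordinal il)) mxE.
    rewrite [RHS]rowx_out //; case: (ltnP i n) => jn; last by rewrite rowx_out.
    rewrite (rowxE s (Ordinal jn)).
    have P g' : 0 <= s (Ordinal jn) g'.
      by apply: s0; rewrite /special /= [(i < 2)%N]ltnNge (leq_trans l2 il) andbF.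
    apply: (sum0_nonneg (f := s (Ordinal jn))) P.
    rewrite -rs big1 // => h _; apply: rd => /=.
    by rewrite neq_ltn (leq_trans (ltn_ord h) il).
  have c1 : strc r s q = 1.
    apply: strc_diagl => // i j ij; rewrite -rs (bigD1 i) //= big1 ?addr0 // => i' ii'.
    by rewrite rd // -ij.
  rewrite -(fsbig_widen [set q]) // ?fsbig_set1; last first.
    move=> q' [_ /= qq']; case: (eqVneq (strc r s q') 0) => [->|]; first by rewrite mul0r.
    case/(strc_diagl_neq0 rd)=> _ sq'; case: qq'; apply/matrixP => i g.
    by have := sq' i g; rewrite sq !rowxE.
  rewrite c1 mul1r (col_multinom_rowx sq) [X in X * _]big1 ?mul1r // => k _.
  by apply: multinom_single => i ik; apply: rd.
have [i [j [ij rij]]] : exists (i : 'I_l) (j : 'I_n), i != j :> nat /\ r i j != 0.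
  apply: contrapT => h; apply: nd => i j ij; apply/eqP/negPn/negP => rij.
  by apply: h; exists i, j.
have ijs : ~~ special i j by rewrite /special (negbTE ij).
have rp : 0 < r i j by rewrite lt_def rij r0.
have rv : entry_val r i j != 0 by rewrite entry_val_off // intr_eq0.
have r0' : Tnonneg (r - delta_mx i j).
  move=> i' j' h; rewrite !mxE; case: eqP h => [->|_]; case: eqP => [->|_] h /=;
    rewrite ?subr0 ?r0 //; lia.
apply: (mulfI rv); rewrite mulr_fsumr mulrA col_multinom_decr // rs.
transitivity (\sum_(q \in setT) \sum_(k < m.+2) (offset k k + (\sum_j s j k)%:~R)
   * strc (r - delta_mx i j) (s - delta_mx j k) (q - delta_mx i k)
   * col_multinom (q - delta_mx i k)).
  apply: eq_fsbigr => q _; rewrite mulrA strc_recl mulr_suml.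
  apply: eq_bigr => k _.
  have [->|c0] := eqVneq (strc (r - delta_mx i j) (s - delta_mx j k)
    (q - delta_mx i k)) 0; first by rewrite !(mulr0, mul0r).
  rewrite mulrAC col_multinom_decr; last exact: strc_nonneg3 c0.
  rewrite mulrAC.
  suff -> : \sum_j s j k = \sum_i q i k by [].
  have := strc_rows23 c0 k; under eq_bigr do rewrite !mxE eqxx andbT.
  under [RHS]eq_bigr do rewrite !mxE eqxx andbT.
  by rewrite !sumrB !sum1 => /addIr.
rewrite fsum_exchange => [|k]; last first.
  exact: (@finite_strcl _ _ _ _ _ _ _ (fun k : 'I_m.+2 => offset k k + (\sum_j s j k)%:~R)
    (fun k q => col_multinom (q - delta_mx i k))
    (fun k => r - delta_mx i j) (fun k => s - delta_mx j k)
    (fun k => delta_mx i k) k).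
transitivity (\sum_(k < m.+2) col_multinom (r - delta_mx i j) * (entry_val s j k * col_multinom s)).
  apply: eq_bigr => k _.
  rewrite (fsum_translate (fun q => (offset k k + (\sum_j s j k)%:~R)
   * strc (r - delta_mx i j) (s - delta_mx j k) q * col_multinom q) (delta_mx i k)).
  under eq_fsbigr do rewrite -mulrA; rewrite -mulr_fsumr.
  have [s0'|ns0] := pselect (Tnonneg (s - delta_mx j k)).
    rewrite IH //; first by rewrite mulrCA -col_multinom_decr.
    - rewrite ltnS in rN; apply: leq_trans rN.
      rewrite [X in (_ < X)%N](bigD1 i) // [X in (_ < (X + _))%N](bigD1 j) //=.
      rewrite (bigD1 i) // (bigD1 j) //= !mxE !eqxx /= -!addnA -addSn.
      apply: leq_add; first lia.
      apply: leq_add; apply: leq_sum => a.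
        by rewrite !mxE => /andP[_ /negbTE ->]; rewrite andbF subr0.
      by move=> /negbTE ai; apply: leq_sum => b _; rewrite !mxE ai subr0.
    - move=> j'; under eq_bigr do rewrite !mxE; under [RHS]eq_bigr do rewrite !mxE.
      rewrite !sumrB rs; congr (_ - _).
      case: (j' == j); last by rewrite !big1 // => ? _; rewrite andbF.
      by under eq_bigr do rewrite andbT; rewrite !sum1.
  rewrite fsbig1 ?mulr0 => [|q _]; last first.
    have [->|/strc_nonneg2//] := eqVneq (strc (r - delta_mx i j) (s - delta_mx j k) q) 0.
    by rewrite mul0r.
  suff -> : entry_val s j k = 0 by rewrite mul0r mulr0.
  have [sjk|sjk] := boolP (special j k).
    exfalso; apply: ns0 => j' k' h; rewrite !mxE.
    by case: eqP h => [->|_]; case: eqP => [->|_] h /=;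
      rewrite ?subr0 ?s0 //; rewrite sjk in h.
  rewrite /entry_val /offset (negbTE sjk) add0r.
  apply/eqP; rewrite intr_eq0; apply: contrapT => /negP sn; apply: ns0 => j' k' h.
  rewrite !mxE; case: eqP h => [->|_]; case: eqP => [->|_] h /=; rewrite ?subr0 ?s0 //.
  by have := s0 j k sjk; move: sn; lia.
rewrite -mulr_sumr -mulr_suml sum_entry_val.
by rewrite mulrCA mulrA.
Qed.

End TrivialCharacter.

Section Functor.
Context {F : numFieldType} (x y : F).
Local Notation CL := (C_linear x y).
Let laws : category_laws CL := C_linear_laws x y.

Definition trivial_functor (a b : obj CL) (f : mor a b) : F :=
  fglift (fun q : Tmx a b => col_multinom x y q : F^o) f.

Lemma trivial_functorM (a b c : obj CL) (g : mor b c) (f : mor a b) :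
  trivial_functor (comp g f) = trivial_functor g * trivial_functor f.
Proof.
move: g; apply: (@freeg_linear_ext F (Tmx b c) F^o
    (fun g : mor b c => trivial_functor (comp g f))
    (fun g : mor b c => trivial_functor g * trivial_functor f))
  => [D E|k D|D E|k D|r].
- by rewrite /trivial_functor (compDl laws) fgliftD.
- by rewrite /trivial_functor C_linear_compZl fgliftZ.
- by rewrite /trivial_functor fgliftD mulrDl.
- by rewrite /trivial_functor fgliftZ; apply/esym/mulrA.
move: f; apply: (@freeg_linear_ext F (Tmx a b) F^o
    (fun f : mor a b => trivial_functor (comp (<< r >> : mor b c) f))
    (fun f : mor a b => trivial_functor (<< r >> : mor b c) * trivial_functor f))
  => [D E|k D|D E|k D|s].
- by rewrite /trivial_functor (compDr laws) fgliftD.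
- by rewrite /trivial_functor C_linear_compZr fgliftZ.
- by rewrite /trivial_functor fgliftD mulrDr.
- by rewrite /trivial_functor fgliftZ; apply: mulrCA.
rewrite /trivial_functor compE !liftU !scale1r fglift_sumE dom_fsum.
transitivity (\sum_(q \in [set: Tmx a c]) strc x y r s q * col_multinom x y q).
  by apply: eq_fsbigr => q _; rewrite coeff_comp_basis.
rewrite (Tmx_sum (f := fun q => strc x y r s q * col_multinom x y q)); last first.
  by move=> q; rewrite mulf_eq0 negb_or => /andP[/strc_is_Tmx].
apply: col_multinom_mul => //; try exact: Tmx_nonneg.
by move=> j; rewrite Tmx_col Tmx_row.
Qed.

Lemma trivial_functor1 (a : obj CL) : trivial_functor (idm a) = 1.
Proof.
rewrite /trivial_functor liftU scale1r /col_multinom big1 // => k _.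
by apply: multinom_single => i ik; rewrite mxE -val_eqE (negbTE ik).
Qed.

Lemma idm_neq0 (a : obj CL) : idm a != 0.
Proof.
apply/eqP => h; have := trivial_functor1 a; rewrite h /trivial_functor fglift0.
by move/eqP; rewrite eq_sym oner_eq0.
Qed.

Lemma trivial_functorZ (a b : obj CL) k (f : mor a b) :
  trivial_functor (k *: f) = k * trivial_functor f.
Proof. by rewrite /trivial_functor fgliftZ. Qed.

(** No cancellation occurs at q if a single pair of basis elements contributes. *)
Lemma coeff_comp_single (a b c : obj CL) (g : mor b c) (f : mor a b) r s (q : Tmx a c) :
  coeff r g != 0 -> coeff s f != 0 -> strc x y r s q != 0 ->
  (forall r' s', coeff r' g != 0 -> coeff s' f != 0 -> strc x y r' s' q != 0 ->
    r' = r /\ s' = s) ->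
  coeff q (comp g f) != 0.
Proof.
move=> rg sf rsq only; rewrite coeff_comp.
rewrite (bigD1_seq r) ?uniq_dom ?mem_dom //= (bigD1_seq s) ?uniq_dom ?mem_dom //=.
rewrite big_seq_cond big1 => [|s' /andP[s'f s's]]; last first.
  apply/eqP; apply: contraNT s's; rewrite !mulf_eq0 !negb_or => /andP[/andP[h1 h2] h3].
  by have [_ ->] := only r s' h1 h2 h3.
rewrite addr0 big1 ?addr0 ?mulf_neq0 // => r' r'r; apply: big1 => s' _.
apply/eqP; apply: contraNT r'r; rewrite !mulf_eq0 !negb_or => /andP[/andP[h1 h2] h3].
by have [-> _] := only r' s' h1 h2 h3.
Qed.

Lemma top_exists (a b : obj CL) (f : mor a b) : f != 0 ->
  exists2 r : Tmx a b, coeff r f != 0 &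
    forall r', coeff r' f != 0 -> offdeg r' <= offdeg r.
Proof.
move=> f0.
have : (0 < size (dom f))%N by rewrite lt0n size_eq0 dom_eq0.
rewrite -has_predT => /hasP[r0 r0f _].
have : exists n : nat, `[< exists2 r : Tmx a b, r \in dom f & offdeg r0 + n%:Z <= offdeg r >].
  by exists 0%N; apply/asboolP; exists r0 => //; rewrite addr0.
move=> ex.
pose B := (\sum_(r <- dom f) absz (offdeg r - offdeg r0)%R)%N.
have bd n : `[< exists2 r : Tmx a b, r \in dom f & offdeg r0 + n%:Z <= offdeg r >] -> (n <= B)%N.
  move=> /asboolP[r rf h]; rewrite /B (bigD1_seq r) ?uniq_dom //=.
  by apply: leq_trans (leq_addr _ _); lia.
case: (ex_maxnP ex bd) => n /asboolP[r rf rn] nmax.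
exists r; first by rewrite -mem_dom.
move=> r'; rewrite -mem_dom => r'f; rewrite leNgt; apply/negP => h.
have := nmax n.+1; rewrite ltnn => H; suff: false by [].
by apply: H; apply/asboolP; exists r' => //; rewrite intS; lia.
Qed.

(** The idempotent k^-1 i p has image b, and u |-> p u i is injective on the
    endomorphisms below it. *)
Lemma retract_primitive (a b : obj CL) (i : mor b a) (p : mor a b) (k : F) :
  k != 0 -> comp p i = k *: idm b ->
  (forall u v : mor b b, comp u v = 0 -> u = 0 \/ v = 0) ->
  primitive (k^-1 *: comp i p).
Proof.
move=> k0 pik dom_b.
have pe : comp p (k^-1 *: comp i p) = p.
  rewrite C_linear_compZr (compA laws) pik C_linear_compZl (comp1l laws).
  by rewrite scalerA mulVf ?scale1r.
have ei : comp (k^-1 *: comp i p) i = i.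
  rewrite C_linear_compZl -(compA laws) pik C_linear_compZr (comp1r laws).
  by rewrite scalerA mulVf ?scale1r.
split.
- by rewrite [in LHS]C_linear_compZl -(compA laws) pe.
- move=> e0; case/eqP: (idm_neq0 b); apply: (scalerI k0); rewrite scaler0 -pik.
  by rewrite -ei e0 (comp0l laws) (comp0r laws).
move=> s Hs; have [s1 s2 s3] := Hs.
have se l := orth_absorb laws l Hs.
have : comp (comp p (comp (s ord0) i)) (comp p (comp (s ord_max) i)) = 0.
  rewrite -!(compA laws) (compA laws i p).
  have -> : comp i p = k *: (k^-1 *: comp i p) by rewrite scalerA mulfV ?scale1r.
  rewrite C_linear_compZl !C_linear_compZr (compA laws (k^-1 *: _)).
  rewrite (se ord_max).1 (compA laws (s ord0)) s2 //.
  by rewrite (comp0l laws) (comp0r laws) scaler0.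
have back l : comp p (comp (s l) i) = 0 -> s l = 0.
  move=> h; rewrite -(se l).1 -(se l).2 C_linear_compZl !C_linear_compZr.
  by rewrite -(compA laws) (compA laws (s l)) (compA laws p) h
    (comp0l laws) (comp0r laws) !scaler0.
by case/dom_b => /back; [exists ord0|exists ord_max].
Qed.

End Functor.

(** * Linear dependence and small matrices *)

Section LinearDependence.
Context {F : fieldType} {T : choiceType}.

Lemma freeg_dependent (I : finType) (v : I -> {freeg T / F}) (X : seq T) :
  (forall i q, coeff q (v i) != 0 -> q \in X) -> (size X < #|I|)%N ->
  exists2 c : I -> F, (exists i, c i != 0) & \sum_i c i *: v i = 0.
Proof.
move=> vX szX.
pose A : 'M[F]_(#|I|, size X) := \matrix_(i, k) coeff (tnth (in_tuple X) k) (v (enum_val i)).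
have : kermx A != 0.
  rewrite kermx_eq0 /row_free neq_ltn (leq_ltn_trans (rank_leq_col A)) //.
case/matrix0Pn=> i [j Kij].
exists (fun u => kermx A i (enum_rank u)); first by exists (enum_val j); rewrite enum_valK.
apply: eq_coeff => q; rewrite coeff0 raddf_sum /=.
under eq_bigr do rewrite coeffZ.
have [qX|qX] := boolP (q \in X); last first.
  apply: big1 => u _; have [->|/vX] := eqVneq (coeff q (v u)) 0; first by rewrite mulr0.
  by rewrite (negbTE qX).
have kq : (index q X < size X)%N by rewrite index_mem.
have := congr1 (fun B : 'M_(_, _) => B i (Ordinal kq)) (mulmx_ker A).
rewrite !mxE => K0; rewrite -[RHS]K0 [RHS](reindex (@enum_rank I)) /=; last first.
  exact: (onW_bij _ (enum_rank_bij _)).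
apply: eq_bigr => u _; rewrite !mxE enum_rankK; congr (_ * coeff _ _).
by rewrite (tnth_nth q) /= nth_index.
Qed.

End LinearDependence.

Section Ordinals.

Local Notation ord1of3 := (@Ordinal 3 1 isT).

Lemma ord2_cases (P : 'I_2 -> Prop) : P ord0 -> P ord_max -> forall i, P i.
Proof.
by move=> P0 P1 [[|[|//]] Hi];
  [rewrite (_ : Ordinal _ = ord0)|rewrite (_ : Ordinal _ = ord_max)] => //;
  apply: val_inj.
Qed.

Lemma ord3_cases (P : 'I_3 -> Prop) : P ord0 -> P ord1of3 -> P ord_max -> forall i, P i.
Proof.
by move=> P0 P1 P2 [[|[|[|//]]] Hi];
  [rewrite (_ : Ordinal _ = ord0)|rewrite (_ : Ordinal _ = ord1of3)
  |rewrite (_ : Ordinal _ = ord_max)] => //; apply: val_inj.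
Qed.

Lemma sum2 (V : nmodType) (f : 'I_2 -> V) : \sum_i f i = f ord0 + f ord_max.
Proof.
by rewrite big_ord_recl big_ord1; congr (_ + f _); apply: val_inj.
Qed.

Lemma sum3 (V : nmodType) (f : 'I_3 -> V) :
  \sum_i f i = f ord0 + f ord1of3 + f ord_max.
Proof.
rewrite !big_ord_recl big_ord0 addr0 addrA.
by congr (_ + f _ + f _); apply: val_inj.
Qed.

Lemma eq_mx2 (A B : 'M[int]_2) :
  A ord0 ord0 = B ord0 ord0 -> A ord0 ord_max = B ord0 ord_max ->
  A ord_max ord0 = B ord_max ord0 -> A ord_max ord_max = B ord_max ord_max ->
  A = B.
Proof. by move=> *; apply/matrixP; apply: ord2_cases; apply: ord2_cases. Qed.

Lemma offdeg2 (q : 'M[int]_2) : offdeg q = q ord0 ord_max + q ord_max ord0.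
Proof. by rewrite /offdeg sum2 !sum2 /= !mul0r !mul1r add0r addr0. Qed.

Lemma offdeg3 (q : 'M[int]_3) :
  offdeg q = q ord0 ord1of3 + q ord0 ord_max + q ord1of3 ord0
    + q ord1of3 ord_max + q ord_max ord0 + q ord_max ord1of3.
Proof.
by rewrite /offdeg sum3 !sum3 /= !mul0r !mul1r !add0r !addr0 !addrA.
Qed.

End Ordinals.

(** * Objects with two rows *)

Section TwoRows.
Context {F : numFieldType} (x y : F).
Local Notation CL := (C_linear x y).
Let laws : category_laws CL := C_linear_laws x y.

Fact two_row_sum (z : int) : z + (- z) + (sumn (@Composition [::] isT))%:Z = 0.
Proof. by rewrite subrr. Qed.

Definition two_row (z : int) : Tseq := TSeq (two_row_sum z).

Section Entries.
Variables (z z' : int) (q : Tmx (two_row z) (two_row z')).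
Let m : 'M[int]_2 := q.

Lemma two_rowP : [/\ m ord0 ord0 + m ord0 ord_max = z',
  m ord_max ord0 + m ord_max ord_max = - z', m ord0 ord0 + m ord_max ord0 = z,
  0 <= m ord0 ord_max & 0 <= m ord_max ord0].
Proof.
have r i : \sum_(k < 2) m i k = entry (two_row z') i := Tmx_row q i.
have c k : \sum_(i < 2) m i k = entry (two_row z) k := Tmx_col q k.
have n : Tnonneg m := @Tmx_nonneg _ _ q.
split; [exact: etrans (esym (sum2 (m ord0))) (r ord0)
  | exact: etrans (esym (sum2 (m ord_max))) (r ord_max)
  | exact: etrans (esym (sum2 (fun i => m i ord0))) (c ord0)
  | exact: n | exact: n].
Qed.

Lemma two_row_offdeg : offdeg q = m ord0 ord_max + m ord_max ord0.
Proof. exact: (offdeg2 m). Qed.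

End Entries.

(** Given the margins, a 2 x 2 matrix has one degree of freedom. *)
Lemma two_row_inj z z' (q q' : Tmx (two_row z) (two_row z')) :
  offdeg q = offdeg q' -> q = q'.
Proof.
have [a1 a2 a3 a4 a5] := two_rowP q; have [b1 b2 b3 b4 b5] := two_rowP q'.
by rewrite !two_row_offdeg => E; apply/val_inj/(@eq_mx2 q q'); lia.
Qed.

Lemma two_row_lead z z' z'' (g : @mor _ CL (two_row z') (two_row z''))
    (f : @mor _ CL (two_row z) (two_row z')) : g != 0 -> f != 0 ->
  exists r s q, [/\ coeff r g != 0, coeff s f != 0, coeff q (comp g f) != 0
    & offdeg (Tmx_mx q) = offdeg (Tmx_mx r) + offdeg (Tmx_mx s)].
Proof.
move=> g0 f0; have [r rg rmax] := top_exists g0; have [s sf smax] := top_exists f0.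
pose rm : 'M[int]_2 := r; pose sm : 'M[int]_2 := s.
have n1 : Tnonneg rm := @Tmx_nonneg _ _ r.
have n2 : Tnonneg sm := @Tmx_nonneg _ _ s.
have rs j : \sum_i rm i j = \sum_k sm j k.
  exact: etrans (Tmx_col r j) (esym (Tmx_row s j)).
have td (i : 'I_2) : (2 <= i)%N -> 0 <= topdiag rm sm i by rewrite leqNgt ltn_ord.
have c0 : strc x y r s (topmx rm sm) != 0 := strc_top x y n1 n2 rs td.
pose q : Tmx (two_row z) (two_row z'') := TMx (strc_is_Tmx c0).
have dq : offdeg (Tmx_mx q) = offdeg (Tmx_mx r) + offdeg (Tmx_mx s).
  exact: offdeg_topmx.
have c1 : strc x y r s q != 0 := c0.
exists r, s, q; split; [exact: rg|exact: sf| |exact: dq].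
apply: (@coeff_comp_single F x y _ _ _ g f r s q rg sf c1) => r' s' r'g s'f c'.
have := strc_offdeg c'; rewrite dq; have := rmax r' r'g; have := smax s' s'f => h1 h2 h3.
by split; apply: two_row_inj; lia.
Qed.

Lemma two_row_domain z (u v : @mor _ CL (two_row z) (two_row z)) :
  comp u v = 0 -> u = 0 \/ v = 0.
Proof.
move=> uv; have [->|u0] := eqVneq u 0; first by left.
have [->|v0] := eqVneq v 0; first by right.
have [r [s [q [_ _ + _]]]] := two_row_lead u0 v0.
by rewrite uv coeff0 eqxx.
Qed.

Lemma offdeg_diag n (q : 'M[int]_n) : is_diag q -> offdeg q = 0.
Proof.
move=> qd; apply: big1 => i _; apply: big1 => k _.
by case: eqP => [_|/eqP ik]; rewrite ?mul0r // qd ?mulr0.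
Qed.

(** The off-diagonal entries of a matrix between distinct objects differ by
    z' - z, so its degree is positive, and leading terms cannot cancel. *)
Lemma two_row_not_retract z z' k (u : @mor _ CL (two_row z) (two_row z'))
    (v : @mor _ CL (two_row z') (two_row z)) :
  z != z' -> k != 0 -> comp v u <> k *: idm (two_row z : obj CL).
Proof.
move=> zz' k0 vu.
have id0 : k *: idm (two_row z : obj CL) != 0.
  by rewrite scaler_eq0 (negbTE k0) idm_neq0.
have v0 : v != 0 by apply: contraNneq id0 => v0; rewrite -vu v0 (comp0l laws).
have u0 : u != 0 by apply: contraNneq id0 => u0; rewrite -vu u0 (comp0r laws).
have [r [s [q [_ _ + dq]]]] := two_row_lead v0 u0.
rewrite vu coeffZ coeffU; have [e|ne] := eqVneq (Tdiag (two_row z)) q; last first.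
  by rewrite -[false%:R]/(0 : F) !mulr0 eqxx.
move=> _; move: dq; rewrite -e (@offdeg_diag _ (diag_mx_of _)); last exact: diag_mx_of_diag.
have [a1 a2 a3 a4 a5] := two_rowP r; have [b1 b2 b3 b4 b5] := two_rowP s.
rewrite !two_row_offdeg; move: zz'; lia.
Qed.

End TwoRows.

(** * The retractions of M^(kappa_1 - 1, kappa_2, 1) *)

Section AlphaOne.
Context {F : numFieldType} (x y : F).
Local Notation CL := (C_linear x y).
Let laws : category_laws CL := C_linear_laws x y.
Local Notation ord1of3 := (@Ordinal 3 1 isT).

Lemma Tmx_transpose a b (q : Tmx a b) : @is_Tmx b a (q : 'M[int]_(len b, len a))^T.
Proof.
apply/and3P; split.
- apply/forallP => i; apply/forallP => k; apply/implyP => h; rewrite mxE.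
  by apply: Tmx_nonneg; apply: contra h => /andP[/eqP ->]; rewrite eqxx.
- by apply/forallP => i; under eq_bigr do rewrite mxE; rewrite Tmx_col.
- by apply/forallP => i; under eq_bigr do rewrite mxE; rewrite Tmx_row.
Qed.

Section Retract.
Variable i0 : 'I_2.

(** The last entry is merged with the entry i0; the target is (kappa_1, kappa_2)
    for i0 = 0 and (kappa_1 - 1, kappa_2 + 1) for i0 = 1. *)
Definition retract_shift : int := if i0 == ord0 then 0 else - 1.
Local Notation W := (two_row retract_shift).

Definition merge_mx : 'M[int]_(2, 3) :=
  \matrix_(i, j) (- ((i == 0%N :> nat) && (j == 0%N :> nat))%:R
                  + ((i == i0) && (j == 2 :> nat))%:R).

Fact merge_is_Tmx : @is_Tmx alpha1 W merge_mx.
Proof.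
have rows (i : 'I_2) : \sum_(k < 3) merge_mx i k = entry W i.
  by rewrite sum3 !mxE /= /entry /= /retract_shift; elim/ord2_cases: i0;
     elim/ord2_cases: i.
have cols (k : 'I_3) : \sum_(i < 2) merge_mx i k = entry alpha1 k.
  by rewrite sum2 !mxE /= /entry /=; elim/ord2_cases: i0; elim/ord3_cases: k.
apply/and3P; split.
- apply/forallP => i; apply/forallP => k; apply/implyP; rewrite mxE.
  by elim/ord2_cases: i0; elim/ord2_cases: i; elim/ord3_cases: k.
- by apply/forallP => i; apply/eqP; apply: rows.
- by apply/forallP => i; apply/eqP; apply: cols.
Qed.

Definition merge : Tmx alpha1 W := TMx merge_is_Tmx.
Definition split_off : Tmx W alpha1 := TMx (Tmx_transpose merge).

(** The entry i0 of the target: kappa_1 or kappa_2 + 1. *)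
Definition retract_scalar : F := if i0 == ord0 then x else y + 1.

(** Use [strc_recl] for the entry 1 of merge_mx at (i0,2); what remains is a
    product of diagonal matrices. *)
Lemma strc_merge (q : 'M[int]_2) :
  strc x y merge_mx merge_mx^T q
  = if q == diag_mx_of W then retract_scalar else 0.
Proof.
pose d : 'M[int]_(2, 3) := merge_mx - delta_mx i0 ord_max.
have dE i j : d i j = - ((i == 0%N :> nat) && (j == 0%N :> nat))%:R.
  rewrite !mxE -[(j == 2 :> nat)]/(j == ord_max) addrK //.
have dd : is_diag d.
  move=> i j ij; rewrite dE.
  by case: (nat_of_ord i) ij => [|?]; case: (nat_of_ord j) => [|?].
have dT : d^T = merge_mx^T - delta_mx ord_max i0 by rewrite linearB /= trmx_delta.
pose D : 'M[int]_2 := diag_mx_of W.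
have DE i k : D i k = (if i == k then entry W i else 0) by rewrite mxE.
have dD i k : rowx d^T i k = rowx (D - delta_mx i0 i0) i k.
  case: i => [|[|[|i]]]; last by rewrite !rowx_out.
  - rewrite (rowxE d^T ord0) (rowxE _ ord0) [LHS]mxE dE !mxE /= /retract_shift.
    by elim/ord2_cases: i0; elim/ord2_cases: k.
  - rewrite (rowxE d^T ord1of3) (rowxE _ ord_max) [LHS]mxE dE !mxE /= /retract_shift.
    by elim/ord2_cases: i0; elim/ord2_cases: k.
  - rewrite (rowxE d^T ord_max) rowx_out // mxE dE /= andbF //.
have E1 : entry_val x y merge_mx i0 ord_max = 1.
  rewrite /entry_val mxE eqxx /= andbF /= oppr0 add0r /offset.
  by elim/ord2_cases: i0; rewrite add0r.
rewrite -[LHS]mul1r -E1 strc_recl (bigD1 i0) //= big1 => [|k ki0]; last first.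
  have [->|/strc_nonneg2/(_ ord_max k)] := eqVneq (strc x y (merge_mx - delta_mx i0 ord_max)
    (merge_mx^T - delta_mx ord_max k) (q - delta_mx i0 k)) 0; first by rewrite mulr0.
  have -> : special (@ord_max 2) k = false by rewrite /special andbF.
  by move/(_ isT); rewrite !mxE !eqxx (negbTE ki0) /= andbF.
rewrite addr0 -/d -dT.
have dr (i : 'I_2) (j : 'I_3) : i = j :> nat -> d i j = \sum_k d^T j k.
  move=> ij; rewrite (bigD1 i) //= [d^T j i]mxE big1 ?addr0 // => k ki.
  rewrite [d^T j k]mxE dd // -ij; exact: ki.
have d0 : Tnonneg d^T.
  move=> i k h; rewrite [d^T i k]mxE dE.
  by case: (nat_of_ord i) h => [|?]; case: (nat_of_ord k) => [|?].
have [->|qD] := eqVneq q D.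
  rewrite (strc_diagl x y dd d0 dr dD) mulr1 /entry_val DE eqxx /offset /special eqxx.
  rewrite /retract_scalar /retract_shift.
  by elim/ord2_cases: i0; rewrite /= ?addr0 // opprK.
have [->|/(strc_diagl_neq0 dd)[_ qE]] := eqVneq (strc x y d d^T (q - delta_mx i0 i0)) 0.
  by rewrite mulr0.
case/eqP: qD; apply: (addIr (- delta_mx i0 i0)); apply/matrixP => i k.
by rewrite -[LHS]rowxE -[RHS]rowxE -qE dD.
Qed.

Lemma merge_split_off :
  comp (<< merge >> : @mor _ CL alpha1 W) (<< split_off >> : @mor _ CL W alpha1)
  = retract_scalar *: idm (W : obj CL).
Proof.
apply: eq_coeff => q; rewrite compE !liftU !scale1r coeff_comp_basis.
rewrite coeffZ coeffU mul1r; have := strc_merge q => ->.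
rewrite -[Tdiag W == q]/(diag_mx_of W == q :> 'M[int]_2) eq_sym.
by case: eqP; rewrite ?mulr1 ?mulr0.
Qed.

End Retract.

(** The basis element of degree 2 that exchanges one unit between the first two
    entries and fixes the last one.  Since the last row has no off-diagonal
    entry, [topmx r step_mx] is admissible for every r. *)
Definition step_mx : 'M[int]_3 :=
  \matrix_(i, j) nth 0 (nth [::] [:: [:: - 2; 1; 0]; [:: 1; - 1; 0]; [:: 0; 0; 1]] i) j.

Fact step_is_Tmx : @is_Tmx alpha1 alpha1 step_mx.
Proof.
have rows (i : 'I_3) : \sum_(k < 3) step_mx i k = entry alpha1 i.
  by rewrite sum3 !mxE; elim/ord3_cases: i.
have cols (k : 'I_3) : \sum_(i < 3) step_mx i k = entry alpha1 k.
  by rewrite sum3 !mxE; elim/ord3_cases: k.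
apply/and3P; split.
- apply/forallP => i; apply/forallP => k; apply/implyP; rewrite mxE.
  by elim/ord3_cases: i; elim/ord3_cases: k.
- by apply/forallP => i; apply/eqP; apply: rows.
- by apply/forallP => i; apply/eqP; apply: cols.
Qed.

Definition step : Tmx alpha1 alpha1 := TMx step_is_Tmx.

Lemma offdeg_step : offdeg step = 2.
Proof. by rewrite (offdeg3 step_mx) !mxE. Qed.

End AlphaOne.

(** * Orthogonal idempotents of End(M) *)

Section Bound.
Context {F : numFieldType} (x y : F).
Local Notation CL := (C_linear x y).
Let laws : category_laws CL := C_linear_laws x y.
Local Notation ord1of3 := (@Ordinal 3 1 isT).
Local Notation A := (@mor _ CL alpha1 alpha1).
Implicit Types u v f : A.

Lemma alpha1P (q : Tmx alpha1 alpha1) : let m : 'M[int]_3 := q in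
  [/\ m ord0 ord0 + m ord0 ord1of3 + m ord0 ord_max = - 1
    & m ord1of3 ord0 + m ord1of3 ord1of3 + m ord1of3 ord_max = 0] /\
  [/\ m ord_max ord0 + m ord_max ord1of3 + m ord_max ord_max = 1,
      m ord0 ord0 + m ord1of3 ord0 + m ord_max ord0 = - 1,
      m ord0 ord1of3 + m ord1of3 ord1of3 + m ord_max ord1of3 = 0
    & m ord0 ord_max + m ord1of3 ord_max + m ord_max ord_max = 1].
Proof.
move=> m.
have r (i : 'I_3) : \sum_(k < 3) m i k = entry alpha1 i := Tmx_row q i.
have c (k : 'I_3) : \sum_(i < 3) m i k = entry alpha1 k := Tmx_col q k.
by split; split; [have := r ord0|have := r ord1of3|have := r ord_max
  |have := c ord0|have := c ord1of3|have := c ord_max]; rewrite sum3.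
Qed.

Lemma alpha1_nonneg (q : Tmx alpha1 alpha1) : let m : 'M[int]_3 := q in
  [/\ 0 <= m ord0 ord1of3, 0 <= m ord0 ord_max & 0 <= m ord1of3 ord0] /\
  [/\ 0 <= m ord1of3 ord_max, 0 <= m ord_max ord0, 0 <= m ord_max ord1of3
    & 0 <= m ord_max ord_max].
Proof.
move=> m; have n : Tnonneg m := @Tmx_nonneg _ _ q.
by split; split; apply: n.
Qed.

Lemma eq_mx3 (B D : 'M[int]_3) :
  [/\ B ord0 ord0 = D ord0 ord0, B ord0 ord1of3 = D ord0 ord1of3
    & B ord0 ord_max = D ord0 ord_max] ->
  [/\ B ord1of3 ord0 = D ord1of3 ord0, B ord1of3 ord1of3 = D ord1of3 ord1of3
    & B ord1of3 ord_max = D ord1of3 ord_max] ->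
  [/\ B ord_max ord0 = D ord_max ord0, B ord_max ord1of3 = D ord_max ord1of3
    & B ord_max ord_max = D ord_max ord_max] ->
  B = D.
Proof.
move=> [? ? ?] [? ? ?] [? ? ?]; apply/matrixP.
by apply: ord3_cases; apply: ord3_cases.
Qed.

Lemma Tmx_offdiag (q q' : Tmx alpha1 alpha1) :
  (forall i k : 'I_3, i != k -> (q : 'M[int]_3) i k = (q' : 'M[int]_3) i k) -> q = q'.
Proof.
move=> E; apply/val_inj/(@eq_mx3 q q');
  have [[a1 a2] [a3 _ _ _]] := alpha1P q; have [[b1 b2] [b3 _ _ _]] := alpha1P q';
  have E1 := E ord0 ord1of3 isT; have E2 := E ord0 ord_max isT;
  have E3 := E ord1of3 ord0 isT; have E4 := E ord1of3 ord_max isT;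
  have E5 := E ord_max ord0 isT; have E6 := E ord_max ord1of3 isT;
  by split; lia.
Qed.

Definition topdeg f (d : int) : Prop :=
  (exists2 r : Tmx alpha1 alpha1, coeff r f != 0 & offdeg r = d) /\
  (forall r : Tmx alpha1 alpha1, coeff r f != 0 -> offdeg r <= d).

Lemma topdeg_exists f : f != 0 -> exists d, topdeg f d.
Proof.
by move=> f0; have [r rf rm] := top_exists f0; exists (offdeg r); split=> //; exists r.
Qed.

Definition shift_by_step f : A := comp f (<< step >> : A).

Lemma coeff_comp_neq0 f g (q : Tmx alpha1 alpha1) : coeff q (comp g f : A) != 0 ->
  exists r s, [/\ coeff r g != 0, coeff s f != 0 & strc x y r s q != 0].
Proof.
move=> h; apply: contrapT => nh; move/eqP: h; apply.
rewrite coeff_comp big1 // => r _; rewrite big1 // => s _.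
apply/eqP; apply: contrapT => /negP; rewrite !mulf_eq0 !negb_or.
by move=> /andP[/andP[h1 h2] h3]; apply: nh; exists r, s.
Qed.

(** For fixed right factor, distinct r have distinct [topmx r step_mx], so the
    leading terms of f are mapped to linearly independent ones. *)
Lemma topdeg_step f d : topdeg f d -> topdeg (shift_by_step f) (d + 2).
Proof.
have stepE s : coeff s (<< step >> : A) != 0 -> s = step.
  by rewrite coeffU mul1r; case: (step =P s) => [->//|_]; rewrite -[false%:R]/(0 : F) eqxx.
case=> -[r rf rd] rmax; split; last first.
  move=> q /coeff_comp_neq0[r' [s [r'f /stepE -> c]]].
  by apply: le_trans (strc_offdeg c) _; rewrite offdeg_step lerD2r rmax.
pose rm : 'M[int]_3 := r.
have n1 : Tnonneg rm := @Tmx_nonneg _ _ r.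
have n2 : Tnonneg step_mx := @Tmx_nonneg _ _ step.
have rs j : \sum_i rm i j = \sum_k step_mx j k.
  exact: etrans (Tmx_col r j) (esym (Tmx_row step j)).
have td (i : 'I_3) : (2 <= i)%N -> 0 <= topdiag rm step_mx i.
  (* The only index at least 2 is the last one, where step_mx is diagonal. *)
  elim/ord3_cases: i => // _; rewrite /topdiag big1 ?subr0.
    by have [_ []] := alpha1_nonneg r.
  by move=> k; elim/ord3_cases: k => //; rewrite mxE.
have c0 : strc x y rm step_mx (topmx rm step_mx) != 0 := strc_top x y n1 n2 rs td.
have T : @is_Tmx alpha1 alpha1 (topmx rm step_mx) := @strc_is_Tmx _ x y _ _ _ r step _ c0.
pose q : Tmx alpha1 alpha1 := TMx T.
have dq : offdeg q = d + 2.
  by rewrite -rd -offdeg_step; exact: offdeg_topmx.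
have c1 : strc x y r step q != 0 := c0.
exists q => //.
apply: (@coeff_comp_single F x y _ _ _ f << step >> r step q rf _ c1).
  by rewrite coeffU eqxx mul1r oner_eq0.
move=> r' s' r'f /stepE -> c'; split=> //.
have h1 := rmax r' r'f; have h2 := strc_offdeg c'; rewrite dq offdeg_step in h2.
have h3 : offdeg r' + offdeg step_mx <= offdeg q.
  by rewrite dq [offdeg step_mx]offdeg_step lerD2r.
pose r'm : 'M[int]_3 := r'.
have E : topmx rm step_mx = topmx r'm step_mx.
  exact: (@strc_top_eq F x y 3 r'm step_mx (topmx rm step_mx) c' h3).
apply: Tmx_offdiag => i k ik; have := congr1 (fun B : 'M_3 => B i k) E.
by rewrite !mxE (negbTE ik) => /addIr.
Qed.

Lemma topdeg_iter f d j : topdeg f d -> topdeg (iter j shift_by_step f) (d + (j.*2)%:Z).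
Proof.
move=> fd; elim: j => [|j IH]; first by rewrite addr0.
rewrite iterS doubleS -addn2 PoszD addrA; exact: topdeg_step IH.
Qed.

Lemma comp_iter u f j :
  comp u (iter j shift_by_step f) = iter j shift_by_step (comp u f).
Proof. by elim: j => //= j IH; rewrite -IH; apply: (compA laws). Qed.

Lemma iter_step0 j : iter j shift_by_step 0 = 0.
Proof. by elim: j => //= j ->; apply: (comp0l laws). Qed.

Lemma iter_step_free f d J (c : 'I_J -> F) : topdeg f d ->
  \sum_j c j *: iter j shift_by_step f = 0 -> forall j, c j = 0.
Proof.
move=> fd; elim: J c => [|J IH] c; first by move=> _ [].
rewrite big_ord_recr /= => S.
have cJ : c ord_max = 0.
  have [[r rf rd] _] := topdeg_iter J fd.
  have := congr1 (coeff r) S; rewrite coeff0 coeffD coeffZ raddf_sum /= big1 ?add0r.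
    by move/eqP; rewrite mulf_eq0 (negbTE rf) orbF => /eqP.
  move=> j _; rewrite coeffZ; have [_ jmax] := topdeg_iter j fd.
  have [->|/jmax] := eqVneq (coeff r (iter j shift_by_step f)) 0; first by rewrite mulr0.
  by rewrite rd lerD2l lez_nat leq_double leqNgt ltn_ord.
move: S; rewrite cJ scale0r addr0 => S j.
have [j' ->|->] := unliftP ord_max j; last exact: cJ.
rewrite -[RHS](IH (fun i => c (widen_ord (leqnSn J) i)) S j').
by congr c; apply: val_inj; apply: lift_max.
Qed.

(** A matrix is determined by the entries (0,1), (0,2), (1,2), (2,0), (2,1); the
    last four are 0 or 1 because the last row and column add up to 1. *)
Lemma few_low_degree E (X : seq (Tmx alpha1 alpha1)) : uniq X ->
  (forall q : Tmx alpha1 alpha1, q \in X -> offdeg q <= E%:Z) ->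
  (size X <= 16 * E.+1)%N.
Proof.
move=> Xu XE.
pose key (q : Tmx alpha1 alpha1) : ('I_2 * 'I_2) * ('I_2 * 'I_2) * 'I_E.+1 :=
  let m : 'M[int]_3 := q in
  ((inord (absz (m ord0 ord_max)), inord (absz (m ord1of3 ord_max))),
   (inord (absz (m ord_max ord0)), inord (absz (m ord_max ord1of3))),
   inord (absz (m ord0 ord1of3))).
have inj : {in X &, injective key}.
  move=> q q' qX q'X.
  have := XE _ qX; have := XE _ q'X.
  rewrite (offdeg3 (Tmx_mx q : 'M[int]_3)) (offdeg3 (Tmx_mx q' : 'M[int]_3)).
  have := alpha1P q; have := alpha1P q'; have := alpha1_nonneg q; have := alpha1_nonneg q'.
  rewrite /key; set m : 'M[int]_3 := q; set m' : 'M[int]_3 := q' => /=.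
  move=> [[p1 p2 p3] [p4 p5 p6 p7]] [[n1 n2 n3] [n4 n5 n6 n7]].
  move=> [[b1 b2] [b3 b4 b5 b6]] [[a1 a2] [a3 a4 a5 a6]] d' d.
  have inordE n (a b : int) : 0 <= a -> 0 <= b -> a <= n%:Z -> b <= n%:Z ->
      inord (absz a) = inord (absz b) :> 'I_n.+1 -> a = b.
    move=> a0 b0 an bn /(congr1 val); rewrite /= !inordK; lia.
  case=> /inordE e1 /inordE e2 /inordE e3 /inordE e4 /inordE e5.
  have {}e1 : m ord0 ord_max = m' ord0 ord_max by apply: e1; lia.
  have {}e2 : m ord1of3 ord_max = m' ord1of3 ord_max by apply: e2; lia.
  have {}e3 : m ord_max ord0 = m' ord_max ord0 by apply: e3; lia.
  have {}e4 : m ord_max ord1of3 = m' ord_max ord1of3 by apply: e4; lia.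
  have {}e5 : m ord0 ord1of3 = m' ord0 ord1of3 by apply: e5; lia.
  by apply/val_inj/(@eq_mx3 m m'); split; lia.
have := max_card (mem [seq key q | q <- X]).
rewrite (card_uniqP _) ?map_inj_in_uniq // size_map !card_prod !card_ord.
by rewrite !mulnA.
Qed.

(** Let s 0, ..., s 32 be nonzero and orthogonal, of degree at most D.  The
    33 (J + 1) elements (s k) step^j with j <= J have degree at most D + 2 J, where
    there are at most 16 (D + 2 J + 1) basis elements.  For J = 16 D this forces a
    linear relation; multiplying it by s k on the left isolates one of the
    idempotents and contradicts [iter_step_free]. *)
Lemma alpha1_orth_bound u : orth_bound 32 u.
Proof.
move=> m s [s1 s2 _] s0; rewrite leqNgt; apply/negP => m33.
have /choice[d sd] : forall k, exists d, topdeg (s k) d.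
  by move=> k; apply: topdeg_exists; apply/eqP; apply: s0.
pose D := (\sum_k absz (d k))%N; pose J := (16 * D)%N.
pose v (w : 'I_33 * 'I_J.+1) := iter w.2 shift_by_step (s (widen_ord m33 w.1)).
pose X := undup (flatten [seq dom (v w) | w <- enum {: 'I_33 * 'I_J.+1}]).
have vX w q : coeff q (v w) != 0 -> q \in X.
  rewrite -mem_dom => qv; rewrite mem_undup; apply/flatten_mapP; exists w => //.
  by rewrite mem_enum.
have XE q : q \in X -> offdeg (Tmx_mx q) <= (D + J.*2)%N%:Z.
  rewrite mem_undup => /flatten_mapP[[k j] _]; rewrite mem_dom => qv.
  have [_ /(_ q qv) h] := topdeg_iter j (sd (widen_ord m33 k)).
  apply: le_trans h _; rewrite PoszD lerD //; last first.
    by rewrite lez_nat leq_double -ltnS.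
  have : (absz (d (widen_ord m33 k)) <= D)%N by rewrite /D (bigD1 (widen_ord m33 k)) // leq_addr.
  by lia.
have szX : (size X < #|{: 'I_33 * 'I_J.+1}|)%N.
  apply: leq_ltn_trans (few_low_degree (undup_uniq _) XE) _.
  by rewrite card_prod !card_ord /J; lia.
have [c [[k0 j0] c0] S] := freeg_dependent vX szX.
have S0 : comp (s (widen_ord m33 k0)) (\sum_w c w *: v w : A) = 0.
  by rewrite S (comp0r laws).
rewrite (comp_sumr laws) in S0; case/eqP: c0.
apply: (iter_step_free (c := fun j => c (k0, j)) (sd (widen_ord m33 k0))) => //.
transitivity (\sum_(k < 33) \sum_(j < J.+1)
    comp (s (widen_ord m33 k0)) (c (k, j) *: v (k, j) : A)); last first.
  by rewrite pair_big -[RHS]S0; apply: eq_bigr => -[].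
rewrite (bigD1 k0) //= [X in _ = _ + X]big1 ?addr0 => [|k kk0].
  apply: eq_bigr => j _; rewrite -[RHS]/(comp (s (widen_ord m33 k0)) (c (k0, j) *: v (k0, j) : A)).
  by rewrite C_linear_compZr /v comp_iter s1.
apply: big1 => j _.
rewrite -[LHS]/(comp (s (widen_ord m33 k0)) (c (k, j) *: v (k, j) : A)).
rewrite C_linear_compZr /v comp_iter s2 ?iter_step0 ?scaler0 //.
by rewrite eq_sym; apply: contraNneq kk0 => /(congr1 val) /= /val_inj ->.
Qed.

End Bound.

(** * Non-uniqueness *)

Section Final.
Context {F : numFieldType} (x y : F).
Local Notation CL := (C_linear x y).
Let laws : category_laws CL := C_linear_laws x y.

(** If the idempotents with images P and Q were equivalent, then u and v would
    compose with the retractions to morphisms between P and Q whose composite is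
    the nonzero scalar x (y + 1). *)
Lemma Mobj_not_unique : x != 0 -> y + 1 != 0 ->
  ~ unique_decomposition (Mobj x y alpha1).
Proof.
move=> x0 y0.
pose W i0 : obj CL := two_row (retract_shift i0).
pose p i0 : @mor _ CL alpha1 (W i0) := << merge i0 >>.
pose i i0 : @mor _ CL (W i0) alpha1 := << split_off i0 >>.
pose k i0 : F := retract_scalar x y i0.
have pi i0 : comp (p i0) (i i0) = k i0 *: idm (W i0) by exact: merge_split_off.
have k0 i0 : k i0 != 0 by elim/ord2_cases: i0.
pose e i0 := (k i0)^-1 *: comp (i i0) (p i0).
have pe i0 : comp (p i0) (e i0) = p i0.
  rewrite C_linear_compZr (compA laws) pi C_linear_compZl (comp1l laws).
  by rewrite scalerA mulVf ?scale1r.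
have prim i0 : primitive (e i0).
  apply: (retract_primitive (k0 i0) (pi i0)); exact: two_row_domain.
have chie i0 : trivial_functor (e i0) = 1.
  rewrite trivial_functorZ trivial_functorM mulrC [X in X * _]mulrC -trivial_functorM pi.
  by rewrite trivial_functorZ trivial_functor1 mulr1 mulfV.
apply: (not_unique_decomposition laws (chi := @trivial_functor F x y alpha1 alpha1)
  (prim ord0) (prim ord_max) _ _ _ _ _ (@alpha1_orth_bound F x y)).
- exact: trivial_functorM.
- by rewrite /trivial_functor fglift0.
- by rewrite chie oner_eq0.
- by rewrite chie oner_eq0.
move=> u v uv vu.
have E : comp (comp (p ord0) (comp v (i ord_max))) (comp (p ord_max) (comp u (i ord0)))
    = (k ord_max * k ord0) *: idm (W ord0).
  have ie : comp (i ord_max) (p ord_max) = k ord_max *: e ord_max.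
    by rewrite scalerA mulfV ?scale1r.
  rewrite -!(compA laws) (compA laws (i ord_max)) ie.
  rewrite C_linear_compZl !C_linear_compZr -uv -(compA laws u) !(compA laws v u) vu.
  by rewrite !(compA laws (p ord0)) !pe (compA laws (p ord0)) pe pi scalerA.
apply: two_row_not_retract E => //; by rewrite mulf_neq0.
Qed.

End Final.

Lemma zariski_closed_line (F : fieldType) (i : 'I_2) :
  zariski_closed [set v : F * F | (if i == ord0 then v.1 else v.2) + 1 = 0].
Proof.
exists [set ('X_i + 1)%R]; apply/seteqP.
by split=> v /= h => [p ->|]; [|have := h _ erefl];
  rewrite /eval2 mevalD mevalXU meval1.
Qed.

Theorem mainTheorem5 (R : realType) :
  for_generic (fun l1 l2 : R[i] =>
    ~ krull_schmidt (C_spec (l1 + 1) l2) /\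
    ~ unique_decomposition (Mobj (l1 + 1) l2 alpha1)).
Proof.
pose line (n : nat) : 'I_2 := if n is 0%N then ord0 else ord_max.
exists (fun n => [set v : R[i] * R[i] | (if line n == ord0 then v.1 else v.2) + 1 = 0]).
split=> [n|l1 l2 generic].
  split; first exact: zariski_closed_line.
  move/seteqP => [_ /(_ (0, 0) I)] /=.
  by rewrite if_same add0r => /eqP; rewrite oner_eq0.
have nonunique : ~ unique_decomposition (Mobj (l1 + 1) l2 alpha1).
  by apply: Mobj_not_unique; apply/eqP => h; apply: generic;
    [exists 0%N | exists 1%N].
by split=> // /(_ (Mobj (l1 + 1) l2 alpha1))[_].
Qed.
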